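(* Let $A$ be a groupoid atlas and $x\in X_A$. The fundamental group $\pi_1(A,x)$ of the atlas is isomorphic to the fundamental group $\pi_1(NA,x)$ of its (strong) nerve $NA$.
   Context: A groupoid atlas $A=(X_A,\phi_A,\mathcal G_A)$ consists of a set $X_A$, an index set $\phi_A$ with a reflexive relation $\leqslant$, and for each $\alpha\in\phi_A$ a groupoid $\mathcal G_\alpha$ (a local groupoid) with object set $X_\alpha\subset X_A$, such that if $\alpha\leqslant\beta$ then $X_\alpha\cap X_\beta$ is a union of connected components of $\mathcal G_\alpha$ and a functor $\phi_\alpha^\beta:\mathcal G_\alpha|_{X_\alpha\cap X_\beta}\to\mathcal G_\beta|_{X_\alpha\cap X_\beta}$ which is the identity on objects is given ($\mathcal G|_X$ is the full subgroupoid on $X$); $\phi_\alpha^\alpha=\mathrm{id}$ and $\phi_\beta^\gamma\circ\phi_\alpha^\beta=\phi_\alpha^\gamma$ whenever defined. All atlases are assumed covered: $X_A=\bigcup_\alpha X_\alpha$. $A$ is good if for each $x\in X_A$ the set $\phi_x=\{\alpha : x\in X_\alpha\}$ has an initial element $\alpha_x$ ($\alpha_x\leqslant\beta$ for all $\beta\in\phi_x$); it is regular if moreover each $\mathcal G_{\alpha_x}$ is the one-object one-arrow groupoid. The regularization $rA$ has $X_{rA}=X_A$, $\phi_{rA}=\phi_A\sqcup\{\alpha_x\}_{x\in X_A}$, with the relation of $\phi_A$ extended (reflexively) by $\alpha_x\leqslant\alpha$ iff $x\in X_\alpha$ (for $\alpha\in\phi_A$), with $\mathcal G_{\alpha_x}$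 the trivial groupoid on $x$ and the other local groupoids as in $A$; $rA$ is always regular. A morphism $f:A\to B$ is a triple $(X_f,\phi_f,\mathcal G_f)$ with $X_f:X_A\to X_B$ a function, $\phi_f:\phi_A\to\phi_B$ a function preserving $\leqslant$, and functors $\mathcal G_f(\alpha):\mathcal G_\alpha\to\mathcal G_{\phi_f(\alpha)}$ which are $X_f|_{X_\alpha}$ on objects and commute with the structural functors. $f\lhd f'$ means that $\phi_f(\alpha)\leqslant\phi_{f'}(\alpha)$ and $\phi_{\phi_f(\alpha)}^{\phi_{f'}(\alpha)}\circ\mathcal G_f(\alpha)=\mathcal G_{f'}(\alpha)$ for all $\alpha$; $\sim$ is the equivalence relation generated by $\lhd$, and $[f]$ is the class of $f$. The product $A\times B$ has underlying set $X_A\times X_B$, index set $\phi_A\times\phi_B$ with the product relation, and local groupoids $\mathcal G_\alpha\times\mathcal G_\beta$. The line $L$ is the atlas with $X_L=\mathbb Z$, index set the subsets $\{n\}$ and $\{n,n+1\}$ of $\mathbb Z$ ordered by inclusion, and $\mathcal G_s$ the groupoid with object set $s$ and exactly one arrow between any two objects. For $\lambda:L\to A$ let $\lambda_n$ be the local arrow $\mathcal G_\lambda(\{n,n+1\})(n\to n+1)$. $\lambda$ stabilizes to the left (right) if there are $x\in X_A$, $\alpha\in\phi_A$ with $\lambda_n=\mathrm{id}_x\in\mathcal G_\alpha$ for all small (big) enough $n$. For $A$ good: a path is a class $[\lambda]$ of a morphism $\lambda:L\to A$ stabilizing in both directions; a loop at $x$ is a path whose eventual values to the left and right are both $x$. A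 homotopy between paths $l,l'$ is a morphism $H:L\times L\to A$ for which there are integers $N_0,N_1,M_0,M_1$ and $\alpha_0,\alpha_1\in\phi_A$ such that $[H\circ j_{N_0}]=l$, $[H\circ j_{N_1}]=l'$, where $j_N:L\to L\times L$ is the inclusion $n\mapsto(n,N)$, $s\mapsto(s,\{N\})$, and for every local arrow $f$ of $L\times L$, $\mathcal G_H(f)=\mathrm{id}_{x_0}\in\mathcal G_{\alpha_0}$ if the first coordinate of the source of $f$ is less than $M_0$, and $\mathcal G_H(f)=\mathrm{id}_{x_1}\in\mathcal G_{\alpha_1}$ if the first coordinate of the target of $f$ is greater than $M_1$ ($x_0,x_1$ the endpoints). $\pi_1(A,x)$ is the set of homotopy classes of loops at $x$ with multiplication induced by concatenation. For $A$ not good, $\pi_1(A,x):=\pi_1(rA,x)$. The nerve $NA$ of a regular atlas $A$ is the simplicial set whose $n$-simplices are the sequences $x_0\xrightarrow{g_1}x_1\to\cdots\xrightarrow{g_n}x_n$ with $g_1,\dots,g_n$ arrows of a common local groupoid $\mathcal G_\alpha$, modulo the equivalence relation generated by $(g_1,\dots,g_n)\sim(\phi_\alpha^\beta(g_1),\dots,\phi_\alpha^\beta(g_n))$ ($\alpha\leqslant\beta$, whenever defined), with faces and degeneracies as in the nerve of a category. For arbitrary $A$, $NA:=N(rA)$ (for regular $A$ the two agree up to isomorphism). The $0$-simplices of $NA$ are identified with $X_A$. The fundamental group of a simplicial set is that of its geometric realization (equivalently, its edge-path group). *)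

(* Defs.v *)
From HB Require Import structures.
From Stdlib Require Import Relation_Operators.
From mathcomp Require Import all_boot all_order all_algebra.
From mathcomp Require Import boolp classical_sets.

Set Implicit Arguments.
Unset Strict Implicit.
Unset Printing Implicit Defensive.

Import Order.TTheory GRing.Theory Num.Theory.


(* [quot R] is the set of all classes [{u | R t u}]; it is meant for an
   equivalence relation [R], but nothing is required of [R] to form it. *)
Definition quot (T : Type) (R : T -> T -> Prop) : Type :=
  {C : T -> Prop | exists t, C = R t}.

Definition cls (T : Type) (R : T -> T -> Prop) (t : T) : quot R :=
  exist _ (R t) (ex_intro _ t erefl).

Definition repr (T : Type) (R : T -> T -> Prop) (q : quot R) : T :=
  projT1 (cid (proj2_sig q)).

Lemma reprK (T : Type) (R : T -> T -> Prop) (q : quot R) : cls R (repr q) = q.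
Proof.
by case: q => C p; apply: eq_exist; rewrite /repr; case: cid => t /= ->.
Qed.

Notation eqv R := (clos_refl_sym_trans _ R).

Section Eqv.
Variables (T : Type) (R : T -> T -> Prop).

Lemma cls_eqv (t u : T) : eqv R t u -> cls (eqv R) t = cls (eqv R) u.
Proof.
move=> tu; apply: eq_exist; apply/funext => v; apply/propext; split.
- by apply: rst_trans; apply: rst_sym.
- exact: rst_trans.
Qed.

Lemma cls_eqvP (t u : T) : cls (eqv R) t = cls (eqv R) u -> eqv R t u.
Proof. by case=> ->; apply: rst_refl. Qed.

Lemma repr_eqv (t : T) : eqv R (repr (cls (eqv R) t)) t.
Proof. by apply: cls_eqvP; rewrite reprK. Qed.

End Eqv.

Lemma eqv_map (T U : Type) (R : T -> T -> Prop) (S : U -> U -> Prop)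
    (f : T -> U) (t u : T) :
  (forall a b, R a b -> eqv S (f a) (f b)) -> eqv R t u -> eqv S (f t) (f u).
Proof.
move=> fRS; elim=> {t u} [a b /fRS // | a | a b _ | a b c _ ab _ bc].
- exact: rst_refl.
- exact: rst_sym.
- exact: rst_trans ab bc.
Qed.

Definition qmap (T U : Type) (R : T -> T -> Prop) (S : U -> U -> Prop)
  (f : T -> U) (q : quot (eqv R)) : quot (eqv S) := cls (eqv S) (f (repr q)).

Lemma qmapE (T U : Type) (R : T -> T -> Prop) (S : U -> U -> Prop)
    (f : T -> U) (fRS : forall a b, R a b -> eqv S (f a) (f b)) (t : T) :
  qmap S f (cls (eqv R) t) = cls (eqv S) (f t).
Proof. by apply/cls_eqv/(eqv_map fRS)/repr_eqv. Qed.

(* A groupoid whose object set is the subset [gobj] of [X]. *)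
Record groupoid (X : Type) := Groupoid {
  gobj : X -> Prop;
  ghom : X -> X -> Type;
  gsrc : forall x y, ghom x y -> gobj x;
  gtgt : forall x y, ghom x y -> gobj y;
  gid : forall x, gobj x -> ghom x x;
  gcomp : forall x y z, ghom x y -> ghom y z -> ghom x z;
  ginv : forall x y, ghom x y -> ghom y x;
  gcompA : forall x y z w (g : ghom x y) (h : ghom y z) (k : ghom z w),
    gcomp g (gcomp h k) = gcomp (gcomp g h) k;
  gcomp1l : forall x y (ox : gobj x) (g : ghom x y), gcomp (gid ox) g = g;
  gcomp1r : forall x y (oy : gobj y) (g : ghom x y), gcomp g (gid oy) = g;
  gcompVl : forall x y (oy : gobj y) (g : ghom x y),
    gcomp (ginv g) g = gid oy;
  gcompVr : forall x y (ox : gobj x) (g : ghom x y),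
    gcomp g (ginv g) = gid ox
}.

(* The underlying set [X] is a parameter.  [phi h bx by] is defined on the
   arrows of the full subgroupoid of [loc a] on the objects shared with
   [loc b]; [le] is not assumed transitive. *)
Record atlas (X : Type) := Atlas {
  idx : Type;
  le : idx -> idx -> Prop;
  le_refl : forall a, le a a;
  loc : idx -> groupoid X;
  covered : forall x, exists a, gobj (loc a) x;
  inter_components : forall a b, le a b -> forall x y,
    ghom (loc a) x y -> gobj (loc b) x -> gobj (loc b) y;
  phi : forall a b, le a b -> forall x y, gobj (loc b) x -> gobj (loc b) y ->
    ghom (loc a) x y -> ghom (loc b) x y;
  phi_gid : forall a b (h : le a b) x (ax : gobj (loc a) x)
    (bx : gobj (loc b) x), phi h bx bx (gid ax) = gid bx;
  phi_gcomp : forall a b (h : le a b) x y z (bx : gobj (loc b) x)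
    (by_ : gobj (loc b) y) (bz : gobj (loc b) z)
    (f : ghom (loc a) x y) (g : ghom (loc a) y z),
    phi h bx bz (gcomp f g) = gcomp (phi h bx by_ f) (phi h by_ bz g);
  phi_refl : forall a (h : le a a) x y (ax : gobj (loc a) x)
    (ay : gobj (loc a) y) (g : ghom (loc a) x y), phi h ax ay g = g;
  phi_trans : forall a b c (ab : le a b) (bc : le b c) (ac : le a c) x y
    (bx : gobj (loc b) x) (by_ : gobj (loc b) y)
    (cx : gobj (loc c) x) (cy : gobj (loc c) y) (g : ghom (loc a) x y),
    phi bc cx cy (phi ab bx by_ g) = phi ac cx cy g
}.

Notation obj A a := (gobj (loc (a : idx A))).
Notation hom A a := (ghom (loc (a : idx A))).

(* An arrow of one of the local groupoids; the index is part of the data. *)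
Record local_arrow (X : Type) (A : atlas X) := LocalArrow {
  la_idx : idx A;
  la_src : X;
  la_tgt : X;
  la_arr : hom A la_idx la_src la_tgt
}.

Definition initial (X : Type) (A : atlas X) (x : X) (a : idx A) : Prop :=
  obj A a x /\ forall b, obj A b x -> le a b.

Definition good (X : Type) (A : atlas X) : Prop :=
  forall x, exists a : idx A, initial x a.

Definition regular (X : Type) (A : atlas X) : Prop :=
  forall x, exists2 a : idx A, initial x a &
    (forall y, obj A a y -> y = x) /\ (forall g h : hom A a x x, g = h).

Section TrivialGroupoid.
Variables (X : Type) (x : X).

Definition trivial_groupoid : groupoid X.
Proof.
refine (@Groupoid X (fun y => y = x) (fun y z => y = x /\ z = x)
  (fun _ _ => @proj1 _ _) (fun _ _ => @proj2 _ _)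
  (fun _ o => conj o o) (fun _ _ _ g h => conj (proj1 g) (proj2 h))
  (fun _ _ g => conj (proj2 g) (proj1 g)) _ _ _ _ _);
  by move=> *; apply: Prop_irrelevance.
Defined.

End TrivialGroupoid.

Section Regularization.
Variables (X : Type) (A : atlas X).

Definition reg_loc (a : idx A + X) : groupoid X :=
  match a with inl a => loc a | inr x => trivial_groupoid x end.

Definition reg_le (a b : idx A + X) : Prop :=
  match a, b with
  | inl a, inl b => le a b
  | inr x, inl b => obj A b x
  | inr x, inr y => x = y
  | inl _, inr _ => False
  end.

Definition reg_phi (a b : idx A + X) : reg_le a b -> forall x y,
    gobj (reg_loc b) x -> gobj (reg_loc b) y ->
    ghom (reg_loc a) x y -> ghom (reg_loc b) x y :=
  match a, b with
  | inl a, inl b => fun h => phi h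
  | inr z, inl b => fun _ x y bx _ g =>
      eq_rect x (ghom (loc b) x) (gid bx) y (etrans (proj1 g) (esym (proj2 g)))
  | inr _, inr _ => fun _ _ _ bx by_ _ => conj bx by_
  | inl _, inr _ => fun h => False_rect _ h
  end.

Definition reg : atlas X.
Proof.
refine (@Atlas X (idx A + X)%type reg_le _ reg_loc _ _ reg_phi _ _ _ _).
- by case=> //= a; apply: le_refl.
- by move=> x; exists (inr x).
- case=> [a|z] [b|w] //=; first exact: inter_components.
  + by move=> bz x y [-> ->].
  + by move=> -> x y [-> ->].
- case=> [a|z] [b|w] //= h x ax bx; first exact: phi_gid.
  by rewrite (Prop_irrelevance (etrans _ _) erefl).
- case=> [a|z] [b|w] //= h x y t bx by_ bt f g; first exact: phi_gcomp.
  case: f g => [fx fy] [gy gz]; subst.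
  rewrite !(Prop_irrelevance (etrans _ _) erefl) /=.
  by rewrite gcomp1r.
- by case=> [a|z] //= h x y ax ay g; apply: phi_refl.
- case=> [a|u] [b|v] [c|w] //= ab bc ac x y bx by_ cx cy g.
  + exact: phi_trans.
  + case: g => [gx gy]; subst.
    rewrite !(Prop_irrelevance (etrans _ _) erefl) /=.
    by rewrite (Prop_irrelevance cy cx) phi_gid.
  + by congr eq_rect; apply: Prop_irrelevance.
Defined.

Lemma reg_regular : regular reg.
Proof.
move=> x; exists (inr x).
  by split=> // -[b|y] //= ->.
by split=> //= g h; apply: Prop_irrelevance.
Qed.

End Regularization.

Record mor (X Y : Type) (A : atlas X) (B : atlas Y) := Mor {
  mfun : X -> Y;
  midx : idx A -> idx B;
  mle : forall a b, le a b -> le (midx a) (midx b);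
  mobj : forall a x, obj A a x -> obj B (midx a) (mfun x);
  mhom : forall a x y, hom A a x y -> hom B (midx a) (mfun x) (mfun y);
  mhom_gid : forall a x (ax : obj A a x), mhom (gid ax) = gid (mobj ax);
  mhom_gcomp : forall a x y z (g : hom A a x y) (h : hom A a y z),
    mhom (gcomp g h) = gcomp (mhom g) (mhom h);
  mhom_phi : forall a b (h : le a b) x y (bx : obj A b x) (by_ : obj A b y)
    (g : hom A a x y),
    mhom (phi h bx by_ g) = phi (mle h) (mobj bx) (mobj by_) (mhom g)
}.

Definition marrow (X Y : Type) (A : atlas X) (B : atlas Y) (f : mor A B)
    (a : idx A) (x y : X) (g : hom A a x y) : local_arrow B :=
  LocalArrow (mhom f g).

Definition mcomp (X Y Z : Type) (A : atlas X) (B : atlas Y) (C : atlas Z)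
  (f : mor A B) (g : mor B C) : mor A C.
Proof.
refine (@Mor X Z A C (mfun g \o mfun f) (midx g \o midx f)
  (fun _ _ h => mle g (mle f h)) (fun _ _ ax => mobj g (mobj f ax))
  (fun _ _ _ k => mhom g (mhom f k)) _ _ _).
- by move=> a x ax; rewrite !mhom_gid.
- by move=> a x y z k l; rewrite !mhom_gcomp.
- by move=> a b h x y bx by_ k; rewrite !mhom_phi.
Defined.

(* The equality of the functors [phi \o mhom f] and [mhom f'] on [loc a]; on
   the identity arrows it says that [mfun f] and [mfun f'] agree on [obj a]. *)
Definition tri (X Y : Type) (A : atlas X) (B : atlas Y) (f f' : mor A B) :
    Prop :=
  forall a : idx A, exists h : le (midx f a) (midx f' a),
  forall x y (g : hom A a x y),
  exists (bx : obj B (midx f' a) (mfun f x))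
         (by_ : obj B (midx f' a) (mfun f y)),
    LocalArrow (phi h bx by_ (mhom f g)) = LocalArrow (mhom f' g).

Definition mclass (X Y : Type) (A : atlas X) (B : atlas Y) : Type :=
  quot (eqv (@tri X Y A B)).

Definition mcls (X Y : Type) (A : atlas X) (B : atlas Y) (f : mor A B) :
  mclass A B := cls (eqv (@tri X Y A B)) f.

Section Product.
Variables (X Y : Type).

Definition prod_groupoid (G : groupoid X) (H : groupoid Y) :
  groupoid (X * Y).
Proof.
refine (@Groupoid (X * Y)%type
  (fun p => gobj G p.1 /\ gobj H p.2)
  (fun p q => (ghom G p.1 q.1 * ghom H p.2 q.2)%type)
  (fun _ _ g => conj (gsrc g.1) (gsrc g.2))
  (fun _ _ g => conj (gtgt g.1) (gtgt g.2))
  (fun _ o => (gid (proj1 o), gid (proj2 o)))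
  (fun _ _ _ g h => (gcomp g.1 h.1, gcomp g.2 h.2))
  (fun _ _ g => (ginv g.1, ginv g.2)) _ _ _ _ _).
- by move=> *; rewrite /= !gcompA.
- by move=> p q o [g h]; rewrite /= !gcomp1l.
- by move=> p q o [g h]; rewrite /= !gcomp1r.
- by move=> p q o [g h]; rewrite /= (gcompVl (proj1 o)) (gcompVl (proj2 o)).
- by move=> p q o [g h]; rewrite /= (gcompVr (proj1 o)) (gcompVr (proj2 o)).
Defined.

Definition prod_atlas (A : atlas X) (B : atlas Y) : atlas (X * Y).
Proof.
refine (@Atlas (X * Y)%type (idx A * idx B)%type
  (fun a b => le a.1 b.1 /\ le a.2 b.2) _
  (fun a => prod_groupoid (loc a.1) (loc a.2)) _ _
  (fun a b h p q bp bq g =>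
    (phi (proj1 h) (proj1 bp) (proj1 bq) g.1,
     phi (proj2 h) (proj2 bp) (proj2 bq) g.2)) _ _ _ _).
- by move=> a; split; apply: le_refl.
- move=> [x y]; have [a ax] := covered A x; have [b by_] := covered B y.
  by exists (a, b).
- move=> a b [h k] p q [g1 g2] [/= o1 o2].
  by split; [exact: inter_components h _ _ g1 o1
            |exact: inter_components k _ _ g2 o2].
- by move=> a b h p o o' /=; rewrite !phi_gid.
- move=> a b h p q r op oq or f g /=.
  by rewrite (phi_gcomp _ _ (proj1 oq)) (phi_gcomp _ _ (proj2 oq)).
- by move=> a h p q op oq [g1 g2] /=; rewrite !phi_refl.
- move=> a b c ab bc ac p q bp bq cp cq g /=.
  by rewrite (phi_trans _ _ (proj1 ac)) (phi_trans _ _ (proj2 ac)).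
Defined.

End Product.

(* [LV n] and [LE n] name the subsets {n} and {n, n+1} of the integers. *)
Inductive line_idx := LV of int | LE of int.

Definition line_set (s : line_idx) : set int :=
  match s with
  | LV n => [set n]%classic
  | LE n => [set n; (n + 1)%R]%classic
  end.

Definition line_groupoid (s : line_idx) : groupoid int.
Proof.
refine (@Groupoid int (line_set s) (fun m n => line_set s m /\ line_set s n)
  (fun _ _ => @proj1 _ _) (fun _ _ => @proj2 _ _)
  (fun _ o => conj o o) (fun _ _ _ g h => conj (proj1 g) (proj2 h))
  (fun _ _ g => conj (proj2 g) (proj1 g)) _ _ _ _ _);
  by move=> *; apply: Prop_irrelevance.
Defined.

Definition line : atlas int.
Proof.
refine (@Atlas int line_idx
  (fun s t => (line_set s `<=` line_set t)%classic) _ line_groupoid _ _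
  (fun _ _ _ _ _ om on _ => conj om on) _ _ _ _).
- by move=> s; apply: subset_refl.
- by move=> n; exists (LV n).
- by move=> s t st m n [_ sn] _; apply: st.
- by move=> *; apply: (@Prop_irrelevance (_ /\ _)).
- by move=> *; apply: (@Prop_irrelevance (_ /\ _)).
- by move=> *; apply: (@Prop_irrelevance (_ /\ _)).
- by move=> *; apply: (@Prop_irrelevance (_ /\ _)).
Defined.

Definition line_edge (n : int) : hom line (LE n) n (n + 1)%R :=
  conj (or_introl erefl) (or_intror erefl).

(* The inclusion n |-> (n, N), s |-> (s, {N}). *)
Definition line_incl (N : int) : mor line (prod_atlas line line).
Proof.
refine (@Mor int (int * int)%type line (prod_atlas line line)
  (fun n => (n, N)) (fun s => (s, LV N) : idx (prod_atlas line line))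
  (fun _ _ h => conj h (le_refl (LV N : idx line)))
  (fun _ _ o => conj o erefl)
  (fun _ _ _ g => (g, conj erefl erefl)) _ _ _);
  by move=> * /=; congr pair; apply: (@Prop_irrelevance (_ /\ _)).
Defined.

Section Paths.
Variables (X : Type) (A : atlas X).
Implicit Types (l m r : mor line A) (x : X) (a : idx A).

Definition arrow_at l (n : int) : local_arrow A := marrow l (line_edge n).

Definition id_arrow x a (ax : obj A a x) : local_arrow A :=
  LocalArrow (gid ax).

Definition stable_before l x (N : int) : Prop :=
  exists a (ax : obj A a x), forall n : int, (n < N)%R -> arrow_at l n = id_arrow ax.

Definition stable_from l x (N : int) : Prop :=
  exists a (ax : obj A a x), forall n : int, (N <= n)%R -> arrow_at l n = id_arrow ax.

Definition stabilizes l x0 x1 : Prop :=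
  (exists N, stable_before l x0 N) /\ (exists N, stable_from l x1 N).

Definition path (x0 x1 : X) : Type :=
  {c : mclass line A | exists2 l, c = mcls l & stabilizes l x0 x1}.

Definition loop (x : X) : Type := path x x.

Definition path_class (x0 x1 : X) (p : path x0 x1) : mclass line A :=
  proj1_sig p.

Definition homotopic (x0 x1 : X) (p q : path x0 x1) : Prop :=
  exists (H : mor (prod_atlas line line) A) (N0 N1 M0 M1 : int)
         (a0 a1 : idx A) (o0 : obj A a0 x0) (o1 : obj A a1 x1),
  [/\ mcls (mcomp (line_incl N0) H) = path_class p,
      mcls (mcomp (line_incl N1) H) = path_class q
    & forall (s : idx (prod_atlas line line)) (u v : int * int)
             (f : hom (prod_atlas line line) s u v),
        ((u.1 < M0)%R -> marrow H f = id_arrow o0) /\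
        ((M1 < v.1)%R -> marrow H f = id_arrow o1)].

(* [r] runs through [l] up to a time [N] from which [l] is constant, and then
   through [m] from a time [N + k] before which [m] is constant. *)
Definition concatenates l m r (x : X) : Prop :=
  exists N k : int,
  [/\ stable_from l x N, stable_before m x (N + k)%R,
      forall i : int, (i < N)%R -> arrow_at r i = arrow_at l i
    & forall i : int, (N <= i)%R -> arrow_at r i = arrow_at m (i + k)%R].

Definition path_concat (x0 x1 x2 : X) (p : path x0 x1) (q : path x1 x2)
    (s : path x0 x2) : Prop :=
  exists l m r,
  [/\ path_class p = mcls l, path_class q = mcls m, path_class s = mcls r
    & [/\ stabilizes l x0 x1, stabilizes m x1 x2, stabilizes r x0 x2
        & concatenates l m r x1]].

Definition loop_classes (x : X) : Type := quot (@homotopic x x).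

(* The graph of the multiplication of homotopy classes of loops induced by
   concatenation: [u * v = w] when some loops in [u], [v] have a concatenation
   in [w].  For a good atlas this is the graph of a group law. *)
Definition loop_classes_mul (x : X) (u v w : loop_classes x) : Prop :=
  exists p q r : loop x,
  [/\ u = cls _ p, v = cls _ q, w = cls _ r & path_concat p q r].

End Paths.

(* Homotopy classes are only meaningful over good atlases: the fundamental
   group of any other atlas is that of its regularization, which has the same
   points. *)
Definition good_model (X : Type) (A : atlas X) : atlas X :=
  if pselect (good A) then A else reg A.

Definition pi1 (X : Type) (A : atlas X) (x : X) : Type :=
  loop_classes (good_model A) x.

Definition pi1_mul (X : Type) (A : atlas X) (x : X) (u v w : pi1 A x) : Prop :=
  loop_classes_mul u v w.

Record sset := SSet {
  simp : nat -> Type;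
  face : forall n, 'I_n.+2 -> simp n.+1 -> simp n;
  degen : forall n, 'I_n.+1 -> simp n -> simp n.+1;
  face_face : forall n (i : 'I_n.+2) (j : 'I_n.+3) (i' : 'I_n.+3)
      (j' : 'I_n.+2) (s : simp n.+2),
    i' = i :> nat -> j = j'.+1 :> nat -> (i < j)%N ->
    face i (face j s) = face j' (face i' s);
  face_degen_lt : forall n (i : 'I_n.+3) (j : 'I_n.+2) (i' : 'I_n.+2)
      (j' : 'I_n.+1) (s : simp n.+1),
    i' = i :> nat -> j = j'.+1 :> nat -> (i < j)%N ->
    face i (degen j s) = degen j' (face i' s);
  face_degen_eq : forall n (i : 'I_n.+2) (j : 'I_n.+1) (s : simp n),
    i = j :> nat \/ i = j.+1 :> nat -> face i (degen j s) = s;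
  face_degen_gt : forall n (i : 'I_n.+3) (j : 'I_n.+2) (i' : 'I_n.+2)
      (j' : 'I_n.+1) (s : simp n.+1),
    i = i'.+1 :> nat -> j' = j :> nat -> (j.+1 < i)%N ->
    face i (degen j s) = degen j' (face i' s);
  degen_degen : forall n (i : 'I_n.+2) (j : 'I_n.+1) (i' : 'I_n.+1)
      (j' : 'I_n.+2) (s : simp n),
    i' = i :> nat -> j' = j.+1 :> nat -> (i <= j)%N ->
    degen i (degen j s) = degen j' (degen i' s)
}.

Section EdgePath.
Variables (K : sset) (v : simp K 0).

Definition d0 (e : simp K 1) : simp K 0 := face ord0 e.
Definition d1 (e : simp K 1) : simp K 0 := face ord_max e.

(* [(e, true)] is the edge [e] traversed from [d1 e] to [d0 e], and
   [(e, false)] is [e] traversed backwards. *)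
Definition oedge : Type := (simp K 1 * bool)%type.
Definition osrc (a : oedge) : simp K 0 := if a.2 then d1 a.1 else d0 a.1.
Definition otgt (a : oedge) : simp K 0 := if a.2 then d0 a.1 else d1 a.1.
Definition orev (a : oedge) : oedge := (a.1, ~~ a.2).

Fixpoint is_epath (u : simp K 0) (s : seq oedge) (w : simp K 0) : Prop :=
  if s is a :: s' then osrc a = u /\ is_epath (otgt a) s' w else u = w.

Definition eloop : Type := {s : seq oedge | is_epath v s v}.

Inductive emove : seq oedge -> seq oedge -> Prop :=
| EDegen (u : simp K 0) : emove [:: (degen ord0 u, true)] [::]
| EBack (a : oedge) : emove [:: a; orev a] [::]
| ETriangle (t : simp K 2) :
    emove [:: (face ord_max t, true); (face ord0 t, true)]
          [:: (face (lift ord0 ord0) t, true)].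

Definition eloop_move (p q : eloop) : Prop :=
  exists s1 s2 t1 t2 : seq oedge,
  [/\ emove t1 t2, proj1_sig p = s1 ++ t1 ++ s2
    & proj1_sig q = s1 ++ t2 ++ s2].

Lemma is_epath_cat u s t w : is_epath u (s ++ t) w <->
  exists2 m, is_epath u s m & is_epath m t w.
Proof.
elim: s u => [|a s IH] u /=.
  by split=> [|[m ->]] //; exists u.
split=> [[au /IH[m sm tm]]|[m [au sm] tm]]; first by exists m.
by split=> //; apply/IH; exists m.
Qed.

Definition erev (s : seq oedge) : seq oedge := rev (map orev s).

Lemma osrc_orev a : osrc (orev a) = otgt a.
Proof. by case: a => e []. Qed.

Lemma otgt_orev a : otgt (orev a) = osrc a.
Proof. by case: a => e []. Qed.

Lemma orevK : involutive orev.
Proof. by case=> e b; rewrite /orev /= negbK. Qed.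

Lemma is_epath_erev u s w : is_epath u s w -> is_epath w (erev s) u.
Proof.
elim: s u => [|a s IH] u //= [au /IH p].
rewrite /erev /= rev_cons -cats1; apply/is_epath_cat; exists (otgt a) => //=.
by rewrite osrc_orev otgt_orev.
Qed.

Lemma erevK s : erev (erev s) = s.
Proof.
rewrite /erev map_rev revK -map_comp -[RHS]map_id.
by apply: eq_map => a /=; rewrite orevK.
Qed.

Definition enil : eloop := exist (fun s => is_epath v s v) [::] erefl.

Lemma ecat_subproof (p q : eloop) :
  is_epath v (proj1_sig p ++ proj1_sig q) v.
Proof.
by apply/is_epath_cat; exists v; [apply: (proj2_sig p) | apply: (proj2_sig q)].
Qed.

Definition ecat (p q : eloop) : eloop :=
  exist (fun s => is_epath v s v) (proj1_sig p ++ proj1_sig q)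
    (ecat_subproof p q).

Definition einv (p : eloop) : eloop :=
  exist (fun s => is_epath v s v) (erev (proj1_sig p))
    (is_epath_erev (proj2_sig p)).

Lemma eloop_inj (p q : eloop) : proj1_sig p = proj1_sig q -> p = q.
Proof. by case: p q => [s hs] [t ht] /= e; apply: eq_exist. Qed.

Lemma ecat_congl (p p' q : eloop) :
  eqv eloop_move p p' -> eqv eloop_move (ecat p q) (ecat p' q).
Proof.
apply: (eqv_map (f := fun p => ecat p q)) => a b.
case=> s1 [s2] [t1] [t2] [mv ea eb].
apply: rst_step; exists s1, (s2 ++ proj1_sig q), t1, t2.
by split=> //=; rewrite ?ea ?eb !catA.
Qed.

Lemma ecat_congr (p q q' : eloop) :
  eqv eloop_move q q' -> eqv eloop_move (ecat p q) (ecat p q').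
Proof.
apply: eqv_map => a b [s1] [s2] [t1] [t2] [mv ea eb].
apply: rst_step; exists (proj1_sig p ++ s1), s2, t1, t2.
by split=> //=; rewrite ?ea ?eb !catA.
Qed.

Lemma ecatV_aux (s : seq oedge) u w (s1 s2 : seq oedge)
    (p q : eloop) : is_epath u s w ->
  proj1_sig p = s1 ++ (s ++ erev s) ++ s2 -> proj1_sig q = s1 ++ s2 ->
  eqv eloop_move p q.
Proof.
elim/last_ind: s w s1 s2 p q => [|s a IH] w s1 s2 p q.
  by move=> _ ep eq; rewrite (@eloop_inj p q) ?ep ?eq //; apply: rst_refl.
rewrite -cats1 => /is_epath_cat[m us [am _]] ep eq.
have er : erev (s ++ [:: a]) = orev a :: erev s.
  by rewrite /erev map_cat rev_cat.
rewrite er in ep.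
have er_path : is_epath v (s1 ++ (s ++ erev s) ++ s2) v.
  have := proj2_sig p; rewrite ep.
  case/is_epath_cat=> m1 h1 /is_epath_cat[m2 + h2].
  rewrite -catA => /is_epath_cat[m3 h3 /= [e1 [_]]].
  rewrite otgt_orev e1 => h4.
  apply/is_epath_cat; exists m1 => //; apply/is_epath_cat; exists m2 => //.
  by apply/is_epath_cat; exists m3.
pose r : eloop := exist (fun s => is_epath v s v) _ er_path.
apply: (@rst_trans _ _ _ r); last exact: (IH m s1 s2 r q us erefl eq).
apply: rst_step; exists (s1 ++ s), (erev s ++ s2), [:: a; orev a], [::].
by split; [exact: EBack | rewrite ep -!catA | rewrite /= -!catA].
Qed.

Lemma ecatV (p : eloop) : eqv eloop_move (ecat p (einv p)) enil.
Proof.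
apply: (@ecatV_aux (proj1_sig p) v v [::] [::]) => //=; last by rewrite cats0.
exact: (proj2_sig p).
Qed.

Lemma einvK : involutive einv.
Proof. by move=> p; apply: eloop_inj; rewrite /= erevK. Qed.

Lemma eVcat (p : eloop) : eqv eloop_move (ecat (einv p) p) enil.
Proof. by rewrite -{2}(einvK p); apply: ecatV. Qed.

Lemma einv_cong (p q : eloop) :
  eqv eloop_move p q -> eqv eloop_move (einv p) (einv q).
Proof.
move=> pq; have e1 : ecat (einv p) enil = einv p.
  by apply: eloop_inj; rewrite /= cats0.
have e2 : ecat enil (einv q) = einv q by apply: eloop_inj.
rewrite -e1 -e2; apply: (@rst_trans _ _ _ (ecat (einv p) (ecat q (einv q)))).
  by apply/ecat_congr/rst_sym/ecatV.
have -> : ecat (einv p) (ecat q (einv q)) = ecat (ecat (einv p) q) (einv q).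
  by apply: eloop_inj; rewrite /= catA.
apply: ecat_congl; apply: (@rst_trans _ _ _ (ecat (einv p) p)).
  by apply/ecat_congr/rst_sym.
exact: eVcat.
Qed.

(* The combinatorial form of the fundamental group, based at [v], of the
   geometric realization of [K]. *)
Definition edge_group : Type := quot (eqv eloop_move).

HB.instance Definition _ := gen_eqMixin edge_group.
HB.instance Definition _ := gen_choiceMixin edge_group.

Definition eg_cls (p : eloop) : edge_group := cls (eqv eloop_move) p.
Definition eg_one : edge_group := eg_cls enil.
Definition eg_inv (a : edge_group) : edge_group := eg_cls (einv (repr a)).
Definition eg_mul (a b : edge_group) : edge_group :=
  eg_cls (ecat (repr a) (repr b)).

Lemma eg_mulE (p q : eloop) :
  eg_mul (eg_cls p) (eg_cls q) = eg_cls (ecat p q).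
Proof.
apply: cls_eqv; apply: rst_trans (ecat_congl _ _) (ecat_congr _ _);
  exact: repr_eqv.
Qed.

Lemma eg_invE (p : eloop) : eg_inv (eg_cls p) = eg_cls (einv p).
Proof. by apply/cls_eqv/einv_cong/repr_eqv. Qed.

Lemma eg_ind (P : edge_group -> Prop) : (forall p, P (eg_cls p)) -> forall a, P a.
Proof. by move=> Pc a; rewrite -(reprK a); apply: Pc. Qed.

Lemma eg_mulA : associative eg_mul.
Proof.
elim/eg_ind=> p; elim/eg_ind=> q; elim/eg_ind=> r; rewrite !eg_mulE.
by congr eg_cls; apply: eloop_inj; rewrite /= catA.
Qed.

Lemma eg_mul1g : left_id eg_one eg_mul.
Proof.
by elim/eg_ind=> p; rewrite eg_mulE; congr eg_cls; apply: eloop_inj.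
Qed.

Lemma eg_mulg1 : right_id eg_one eg_mul.
Proof.
elim/eg_ind=> p; rewrite eg_mulE; congr eg_cls; apply: eloop_inj.
by rewrite /= cats0.
Qed.

Lemma eg_mulVg : left_inverse eg_one eg_inv eg_mul.
Proof.
by elim/eg_ind=> p; rewrite eg_invE eg_mulE; apply/cls_eqv/eVcat.
Qed.

Lemma eg_mulgV : right_inverse eg_one eg_inv eg_mul.
Proof.
by elim/eg_ind=> p; rewrite eg_invE eg_mulE; apply/cls_eqv/ecatV.
Qed.

HB.instance Definition _ := isGroup.Build edge_group
  eg_mulA eg_mul1g eg_mulg1 eg_mulVg eg_mulgV.

End EdgePath.

Section Chains.
Variables (X : Type) (G : groupoid X).

(* Sequences x -> x1 -> ... -> xn of [n] composable arrows starting at [x]. *)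
Fixpoint chain (n : nat) (x : X) : Type :=
  if n is m.+1 then {y : X & (ghom G x y * chain m y)%type} else gobj G x.

Definition cons_chain (n : nat) (x y : X) (g : ghom G x y) (c : chain n y) :
  chain n.+1 x := existT _ y (g, c).

Definition chain_src n x : chain n x -> gobj G x :=
  match n with 0 => id | m.+1 => fun c => gsrc (projT2 c).1 end.

(* The face d_(k+1), which composes the arrows number k and k+1 (counted from
   0), or drops the last arrow when k = n. *)
Fixpoint chain_face (n k : nat) (x : X) : chain n.+1 x -> chain n x :=
  match n return chain n.+1 x -> chain n x with
  | 0 => @chain_src 1 x
  | m.+1 => fun c => match k with
    | 0 => cons_chain (gcomp (projT2 c).1 (projT2 (projT2 c).2).1)
             (projT2 (projT2 c).2).2
    | k'.+1 => cons_chain (projT2 c).1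
             (@chain_face m k' (projT1 c) (projT2 c).2)
    end
  end.

Fixpoint chain_degen (n k : nat) (x : X) : chain n x -> chain n.+1 x :=
  match n return chain n x -> chain n.+1 x with
  | 0 => fun c => cons_chain (gid c) c
  | m.+1 => fun c => match k with
    | 0 => cons_chain (gid (chain_src c)) c
    | k'.+1 => cons_chain (projT2 c).1
             (@chain_degen m k' (projT1 c) (projT2 c).2)
    end
  end.

Definition seqs (n : nat) : Type := {x : X & chain n x}.

Definition seqs_face (n i : nat) (s : seqs n.+1) : seqs n :=
  match i with
  | 0 => existT _ (projT1 (projT2 s)) (projT2 (projT2 s)).2
  | k.+1 => existT _ (projT1 s) (chain_face k (projT2 s))
  end.

Definition seqs_degen (n i : nat) (s : seqs n) : seqs n.+1 :=
  existT _ (projT1 s) (chain_degen i (projT2 s)).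

Lemma chainP n x (c : chain n.+1 x) :
  exists y (g : ghom G x y) (c' : chain n y), c = cons_chain g c'.
Proof. by case: c => y [g c]; exists y, g, c. Qed.

Lemma cons_gid n x (o o' : gobj G x) (c : chain n x) :
  cons_chain (gid o) c = cons_chain (gid o') c.
Proof. by rewrite (Prop_irrelevance o o'). Qed.

Lemma chain_face_face n k l x (c : chain n.+2 x) : (k <= l)%N ->
  chain_face k (chain_face l.+1 c) = chain_face l (chain_face k c).
Proof.
elim: n k l x c => [|n IH] k l x c kl; first exact: (@Prop_irrelevance (gobj G _)).
have [y [g [c1 ->]]] := chainP c; have [z [h [c2 ->]]] := chainP c1.
case: k l kl => [|k] [|l] // kl.
- by have [w [f [c3 ->]]] := chainP c2; rewrite /cons_chain /= gcompA.
- exact: (congr1 (cons_chain g) (IH k l y (cons_chain h c2) kl)).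
Qed.

Lemma chain_degen0 n x (c : chain n x) :
  chain_degen 0 c = cons_chain (gid (chain_src c)) c.
Proof. by case: n c. Qed.

Lemma chain_face_degen_lt n k l x (c : chain n.+1 x) : (k < l)%N ->
  (l <= n)%N ->
  chain_face k (chain_degen l.+1 c) = chain_degen l (chain_face k c).
Proof.
elim: n k l x c => [|n IH] k l x c kl ln; first by case: l kl ln.
have [y [g [c1 ->]]] := chainP c; have [z [h [c2 ->]]] := chainP c1.
case: k l kl ln => [|k] [|l] // kl ln.
exact: (congr1 (cons_chain g) (IH k l y (cons_chain h c2) kl ln)).
Qed.

Lemma chain_face_degen_eq n k l x (c : chain n x) : (l <= n)%N ->
  k = l \/ k.+1 = l -> chain_face k (chain_degen l c) = c.
Proof.
elim: n k l x c => [|n IH] k l x c ln kl; first exact: (@Prop_irrelevance (gobj G _)).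
have [y [g [c1 ec]]] := chainP c; rewrite {}ec.
case: k l ln kl => [|k] [|l] // ln kl; last 2 first.
- by case: kl.
- apply: (congr1 (cons_chain g) (IH k l y c1 ln _)).
  by case: kl => -[->]; [left|right].
- by rewrite /cons_chain /= gcomp1l.
case: kl => // -[e]; rewrite -{}e.
rewrite [chain_degen _ _]/(cons_chain g (chain_degen 0 c1)) chain_degen0.
by rewrite /cons_chain /= gcomp1r.
Qed.

Lemma chain_face_degen_gt n k l x (c : chain n.+1 x) : (l <= k)%N ->
  (k <= n)%N ->
  chain_face k.+1 (chain_degen l c) = chain_degen l (chain_face k c).
Proof.
elim: n k l x c => [|n IH] k l x c lk kn.
  by case: k l lk kn => [|k] [|l] // _ _; apply: cons_gid.
have [y [g [c1 ->]]] := chainP c.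
case: k l lk kn => [|k] [|l] // lk kn.
- rewrite [RHS]chain_degen0.
  exact: cons_gid.
- exact: (congr1 (cons_chain g) (IH k l y c1 lk kn)).
Qed.

Lemma chain_degen_degen n k l x (c : chain n x) : (k <= l)%N -> (l <= n)%N ->
  chain_degen k (chain_degen l c) = chain_degen l.+1 (chain_degen k c).
Proof.
elim: n k l x c => [|n IH] k l x c kl ln.
  case: l k kl ln => [|l] [|k] // _ _.
  exact: cons_gid.
have [y [g [c1 ->]]] := chainP c.
case: k l kl ln => [|k] [|l] // kl ln; first exact: cons_gid.
exact: (congr1 (cons_chain g) (IH k l y c1 kl ln)).
Qed.

Lemma seqs_face_face n i j (s : seqs n.+2) : (i <= j)%N ->
  seqs_face i (seqs_face j.+1 s) = seqs_face j (seqs_face i s).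
Proof.
case: s => x c; case: i j => [|i] [|j] // ij.
exact: (congr1 (existT (chain n) x) (@chain_face_face n i j x c ij)).
Qed.

Lemma seqs_face_degen_lt n i j (s : seqs n.+1) : (i <= j)%N -> (j <= n)%N ->
  seqs_face i (seqs_degen j.+1 s) = seqs_degen j (seqs_face i s).
Proof.
case: s => x c; case: i => [|i] // ij jn.
exact: (congr1 (existT (chain n.+1) x) (@chain_face_degen_lt n i j x c ij jn)).
Qed.

Lemma seqs_face_degen_eq n i j (s : seqs n) : (j <= n)%N ->
  i = j \/ i = j.+1 -> seqs_face i (seqs_degen j s) = s.
Proof.
case: s => x c jn; case: i => [|i] ij.
  case: ij => // <-; rewrite /seqs_face /seqs_degen /=.
  by rewrite (chain_degen0 c).
apply: (congr1 (existT (chain n) x) (chain_face_degen_eq c jn _)).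
by case: ij => [|[]]; [right|left].
Qed.

Lemma seqs_face_degen_gt n i j (s : seqs n.+1) : (j < i)%N -> (i <= n.+1)%N ->
  seqs_face i.+1 (seqs_degen j s) = seqs_degen j (seqs_face i s).
Proof.
case: s => x c; case: i => [|i] // ij jn.
exact: (congr1 (existT (chain n.+1) x) (@chain_face_degen_gt n i j x c ij jn)).
Qed.

Lemma seqs_degen_degen n i j (s : seqs n) : (i <= j)%N -> (j <= n)%N ->
  seqs_degen i (seqs_degen j s) = seqs_degen j.+1 (seqs_degen i s).
Proof.
case: s => x c ij jn.
exact: (congr1 (existT (chain n.+2) x) (chain_degen_degen c ij jn)).
Qed.

End Chains.

Section Push.
Variables (X : Type) (A : atlas X).

(* The image of a sequence of arrows of [loc a] under [phi].  It is defined
   when all the objects lie in [obj b]; as these form a union of components,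
   it is enough that the first one does. *)
Fixpoint push (a b : idx A) (h : le a b) (n : nat) (x : X) :
    obj A b x -> chain (loc a) n x -> chain (loc b) n x :=
  match n return obj A b x -> chain (loc a) n x -> chain (loc b) n x with
  | 0 => fun bx _ => bx
  | m.+1 => fun bx c =>
      let by_ := inter_components h (projT2 c).1 bx in
      cons_chain (phi h bx by_ (projT2 c).1) (push h by_ (projT2 c).2)
  end.

Definition pre_simplex (n : nat) : Type := {a : idx A & seqs (loc a) n}.

Inductive simplex_step (n : nat) : pre_simplex n -> pre_simplex n -> Prop :=
| SimplexStep (a b : idx A) (h : le a b) (x : X) (bx : obj A b x)
    (c : chain (loc a) n x) :
    simplex_step (existT _ a (existT _ x c))
                 (existT _ b (existT _ x (push h bx c))).

Definition pre_face (n i : nat) (s : pre_simplex n.+1) : pre_simplex n :=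
  existT _ (projT1 s) (seqs_face i (projT2 s)).

Definition pre_degen (n i : nat) (s : pre_simplex n) : pre_simplex n.+1 :=
  existT _ (projT1 s) (seqs_degen i (projT2 s)).

Lemma push_face (a b : idx A) (h : le a b) n k x (bx : obj A b x)
    (c : chain (loc a) n.+1 x) :
  chain_face k (push h bx c) = push h bx (chain_face k c).
Proof.
elim: n k x bx c => [|n IH] k x bx c.
  exact: (@Prop_irrelevance (obj A b x)).
have [y [g [c1 ->]]] := chainP c; case: k => [|k]; last first.
  exact: (congr1 (cons_chain _) (IH k y (inter_components h g bx) c1)).
have [z [f [c2 ->]]] := chainP c1; rewrite /cons_chain /= -phi_gcomp.
by rewrite (Prop_irrelevance (inter_components h (gcomp g f) bx)
                             (inter_components h f (inter_components h g bx))).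
Qed.

Lemma push_gid (a b : idx A) (h : le a b) n x (bx ox' : obj A b x)
    (ox : obj A a x) (c : chain (loc a) n x) :
  push h bx (cons_chain (gid ox) c) = cons_chain (gid ox') (push h bx c).
Proof.
rewrite /cons_chain /= (Prop_irrelevance (inter_components h (gid ox) bx) bx).
by rewrite phi_gid (Prop_irrelevance ox' bx).
Qed.

Lemma push_degen (a b : idx A) (h : le a b) n k x (bx : obj A b x)
    (c : chain (loc a) n x) :
  chain_degen k (push h bx c) = push h bx (chain_degen k c).
Proof.
elim: n k x bx c => [|n IH] k x bx c; first exact/esym/push_gid.
case: k => [|k]; first exact/esym/push_gid.
have [y [g [c1 ->]]] := chainP c.
exact: (congr1 (cons_chain _) (IH k y (inter_components h g bx) c1)).
Qed.

Lemma pre_face_step n i (s t : pre_simplex n.+1) :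
  simplex_step s t -> eqv (@simplex_step n) (pre_face i s) (pre_face i t).
Proof.
case=> a b h x bx c; apply: rst_step; case: i => [|k].
  exact: SimplexStep.
by rewrite /pre_face /= push_face; apply: SimplexStep.
Qed.

Lemma pre_degen_step n i (s t : pre_simplex n) :
  simplex_step s t -> eqv (@simplex_step n.+1) (pre_degen i s) (pre_degen i t).
Proof.
case=> a b h x bx c; apply: rst_step.
by rewrite /pre_degen /seqs_degen /= push_degen; apply: SimplexStep.
Qed.

Definition simplex (n : nat) : Type := quot (eqv (@simplex_step n)).

Definition simplex_cls n (s : pre_simplex n) : simplex n :=
  cls (eqv (@simplex_step n)) s.

Definition simplex_face n (i : 'I_n.+2) : simplex n.+1 -> simplex n :=
  qmap _ (@pre_face n i).

Definition simplex_degen n (i : 'I_n.+1) : simplex n -> simplex n.+1 :=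
  qmap _ (@pre_degen n i).

Lemma simplex_faceE n (i : 'I_n.+2) s :
  simplex_face i (simplex_cls s) = simplex_cls (pre_face i s).
Proof. by apply: qmapE; apply: pre_face_step. Qed.

Lemma simplex_degenE n (i : 'I_n.+1) s :
  simplex_degen i (simplex_cls s) = simplex_cls (pre_degen i s).
Proof. by apply: qmapE; apply: pre_degen_step. Qed.

Lemma simplex_ind n (P : simplex n -> Prop) :
  (forall s, P (simplex_cls s)) -> forall s, P s.
Proof. by move=> Pc s; rewrite -(reprK s); apply: Pc. Qed.

(* The sequences of local arrows modulo the structural functors; this is the
   nerve of the atlas when it is regular. *)
Definition regular_nerve : sset.
Proof.
refine (@SSet simplex simplex_face simplex_degen _ _ _ _ _).
- move=> n i j i' j' s; elim/simplex_ind: s => -[a s] ei ej ij.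
  rewrite !simplex_faceE /pre_face /= ei ej seqs_face_face //.
  by rewrite -ltnS -ej.
- move=> n i j i' j' s; elim/simplex_ind: s => -[a s] ei ej ij.
  rewrite !(simplex_faceE, simplex_degenE) /pre_face /pre_degen /= ei ej.
  have jn : (j' <= n)%N by rewrite -ltnS ltn_ord.
  by rewrite seqs_face_degen_lt // -ltnS -ej.
- move=> n i j s; elim/simplex_ind: s => -[a s] ij.
  rewrite !(simplex_faceE, simplex_degenE) /pre_face /pre_degen /=.
  by rewrite seqs_face_degen_eq // -ltnS ltn_ord.
- move=> n i j i' j' s; elim/simplex_ind: s => -[a s] ei ej ij.
  rewrite !(simplex_faceE, simplex_degenE) /pre_face /pre_degen /= ei ej.
  have jn : (i' <= n.+1)%N by rewrite -ltnS ltn_ord.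
  by rewrite seqs_face_degen_gt // -ltnS -ei.
- move=> n i j i' j' s; elim/simplex_ind: s => -[a s] ei ej ij.
  rewrite !simplex_degenE /pre_degen /= ei ej seqs_degen_degen //.
  by rewrite -ltnS ltn_ord.
Defined.

End Push.

Section Nerve.
Variables (X : Type) (A : atlas X).

Definition nerve : sset := regular_nerve (reg A).

Definition nerve_vertex (x : X) : simp nerve 0 :=
  simplex_cls (existT _ (inr x : idx (reg A)) (existT _ x erefl)
    : pre_simplex (reg A) 0).

Lemma nerve_vertex_bij : bijective nerve_vertex.
Proof.
pose pt (s : pre_simplex (reg A) 0) : X := projT1 (projT2 s).
have ptE s t : eqv (@simplex_step _ (reg A) 0) s t -> pt s = pt t.
  by elim=> // [{}s {}t [] // | {}s {}t r _ -> _ ->].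
have ptK s : pt (repr (simplex_cls s)) = pt s by apply/ptE/repr_eqv.
exists (fun s => pt (repr s)) => [x|s]; first exact: ptK.
elim/simplex_ind: s => -[a [x c]]; rewrite ptK /pt /=.
apply/cls_eqv/rst_step.
have h : le (inr x : idx (reg A)) a by case: a c => //= y ->.
exact: (@SimplexStep _ (reg A) 0 _ _ h x c (erefl x)).
Qed.

End Nerve.

(* Main.v *)
From Stdlib Require Import Relation_Operators Operators_Properties.
From mathcomp Require Import all_boot all_order all_algebra zify.
From mathcomp Require Import boolp classical_sets.
Require Import Defs.

Set Implicit Arguments.
Unset Strict Implicit.
Unset Printing Implicit Defensive.

(** Why the two groups agree.  A stabilizing morphism from the line to a good
    atlas [B] is, up to the relation [tri], a finite word of composable local
    arrows: the indices chosen at the integers may be replaced by the initial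
    ones, and all but finitely many arrows are identities.  An edge loop of the
    nerve is also such a word, once the edges traversed backwards are replaced
    by inverse arrows.  So both groups are quotients of the same set of words,
    and the point is that they impose the same identifications.

    From homotopies to edge loops: a morphism on [line * line] is a grid of
    squares, each commuting inside one local groupoid.  A commuting square
    yields two triangles of the nerve with a common diagonal
    ([word_class_square]), and sliding a vertical arrow along a row, one square
    at a time, shows that consecutive rows have the same class
    ([homotopy_word_class]).

    From edge loops to homotopies: modulo padding by identities at the right
    end, every elementary move on edge loops lifts to moves that do not change
    the length of a word ([padded_emove]): pushing one arrow along a structural
    functor, or replacing [g, h] by [gcomp g h, id].  The first is a row of
    squares whose vertical sides are identities; in the second the vertical
    arrow in the middle is [h] ([row_homotopy_word_move]).  Keeping the length
    constant is what makes the moves fit in a fixed strip of the plane.  The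
    rows of a finite chain of moves are then assembled into one morphism on the
    plane ([grid_of_arrows], [homotopy_of_word_moves]), so that equality in the
    edge group is realized by a single homotopy; in particular [homotopic] is
    an equivalence relation, although it is defined by one grid only.

    The nerve enters only through [nerve_model], a list of properties of its
    vertices, edges and triangles.  This treats at once a good atlas, whose
    nerve is computed from its regularization, and the regularization itself,
    which replaces an atlas that is not good. *)

(** * Local arrows and words *)

Section LocalArrows.
Variables (X : Type) (B : atlas X).
Implicit Types (a b : idx B) (x y z : X) (g h : local_arrow B).

(** Endpoints of composable local arrows agree only up to propositional
    equality; this transport gives them a common type. *)
Definition as_hom g b x y (eb : la_idx g = b) (ex : la_src g = x)
    (ey : la_tgt g = y) : hom B b x y :=
  match eb in _ = b', ex in _ = x', ey in _ = y' return hom B b' x' y' with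
  | erefl, erefl, erefl => la_arr g
  end.

Lemma as_homK g b x y (eb : la_idx g = b) (ex : la_src g = x)
    (ey : la_tgt g = y) : LocalArrow (as_hom eb ex ey) = g.
Proof. by case: g eb ex ey => i u v g /= eb ex ey; subst. Qed.

Lemma as_hom_id b x y (k : hom B b x y) eb ex ey :
  @as_hom (LocalArrow k) b x y eb ex ey = k.
Proof.
by rewrite (Prop_irrelevance eb erefl) (Prop_irrelevance ex erefl)
  (Prop_irrelevance ey erefl).
Qed.

(** Injectivity of a dependent constructor: it rests on uniqueness of identity
    proofs, here through proof irrelevance. *)
Lemma LocalArrow_inj b x y (k l : hom B b x y) :
  LocalArrow k = LocalArrow l -> k = l.
Proof.
move=> kl; suff H g eb ex ey : g = LocalArrow l -> @as_hom g b x y eb ex ey = l.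
  by rewrite -(H (LocalArrow k) erefl erefl erefl kl).
by move=> eg; subst g; rewrite as_hom_id.
Qed.

Lemma LocalArrow_ends a x y b x' y' (k : hom B a x y) (l : hom B b x' y') :
  LocalArrow k = LocalArrow l -> [/\ a = b, x = x' & y = y'].
Proof.
by move=> e; split; [apply: (congr1 (@la_idx _ B) e)
  | apply: (congr1 (@la_src _ B) e) | apply: (congr1 (@la_tgt _ B) e)].
Qed.

Lemma id_arrow_irr a x (o o' : obj B a x) : id_arrow o = id_arrow o'.
Proof. by rewrite (Prop_irrelevance o o'). Qed.

(** The generating relation of the edges of the nerve: two arrows related by a
    zigzag of such steps represent the same 1-simplex. *)
Inductive arrow_step : local_arrow B -> local_arrow B -> Prop :=
| ArrowStep a b (h : le a b) x y (bx : obj B b x) (by_ : obj B b y)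
    (k : hom B a x y) : arrow_step (LocalArrow k) (LocalArrow (phi h bx by_ k)).

Lemma arrow_stepP a x y b x' y' (k : hom B a x y) (l : hom B b x' y') :
  arrow_step (LocalArrow k) (LocalArrow l) ->
  [/\ x = x', y = y' & exists h : le a b, forall (bx : obj B b x)
     (by_ : obj B b y), LocalArrow (phi h bx by_ k) = LocalArrow l].
Proof.
have H p q : arrow_step p q -> p = LocalArrow k -> q = LocalArrow l ->
  [/\ x = x', y = y' & exists h : le a b, forall (bx : obj B b x)
     (by_ : obj B b y), LocalArrow (phi h bx by_ k) = LocalArrow l]; last first.
  by move=> st; apply: H st erefl erefl.
case=> i j h u v bu bv m em el.
case: (LocalArrow_ends em) => ? ? ?; subst.
have ? := LocalArrow_inj em; subst m.
case: (LocalArrow_ends el) => ? ? ?; subst; split=> //.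
exists h => bx by_; have ? := LocalArrow_inj el; subst l.
by rewrite (Prop_irrelevance bu bx) (Prop_irrelevance bv by_).
Qed.

Lemma arrow_step_refl g : arrow_step g g.
Proof.
case: g => a x y k; have := ArrowStep (le_refl a) (gsrc k) (gtgt k) k.
by rewrite (phi_refl _ (gsrc k) (gtgt k)).
Qed.

Lemma arrow_step_gid a b (h : le a b) x (ax : obj B a x) (bx : obj B b x) :
  arrow_step (id_arrow ax) (id_arrow bx).
Proof. by have := ArrowStep h bx bx (gid ax); rewrite phi_gid. Qed.

Lemma arrow_step_ends g h :
  arrow_step g h -> la_src g = la_src h /\ la_tgt g = la_tgt h.
Proof. by case. Qed.

Lemma eqv_arrow_step_ends g h :
  eqv arrow_step g h -> la_src g = la_src h /\ la_tgt g = la_tgt h.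
Proof.
by elim=> {g h} [g h /arrow_step_ends //|//|g h _ [-> ->]
  |g h k _ [-> ->] _ [-> ->]].
Qed.

Fixpoint is_word x (s : seq (local_arrow B)) z : Prop :=
  if s is g :: s' then la_src g = x /\ is_word (la_tgt g) s' z else x = z.

Lemma is_word_cat x s t z :
  is_word x (s ++ t) z <-> exists2 y, is_word x s y & is_word y t z.
Proof.
elim: s x => [|a s IH] x /=.
  by split=> [|[m ->]] //; exists x.
split=> [[au /IH[m sm tm]]|[m [au sm] tm]]; first by exists m.
by split=> //; apply/IH; exists m.
Qed.

Definition inv_arrow g : local_arrow B := LocalArrow (ginv (la_arr g)).

Lemma gidV a x (ax : obj B a x) : ginv (gid ax) = gid ax.
Proof. by rewrite -[LHS](gcomp1l ax) (gcompVr ax). Qed.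

Lemma phi_ginv a b (h : le a b) x y (bx : obj B b x) (by_ : obj B b y)
    (k : hom B a x y) : phi h by_ bx (ginv k) = ginv (phi h bx by_ k).
Proof.
rewrite -[LHS](gcomp1r bx) -(gcompVr bx (phi h bx by_ k)) gcompA.
by rewrite -phi_gcomp (gcompVl (gtgt k)) phi_gid gcomp1l.
Qed.

Lemma arrow_step_inv g h :
  arrow_step g h -> arrow_step (inv_arrow g) (inv_arrow h).
Proof.
by case=> a b l x y bx by_ k; rewrite /inv_arrow /= -phi_ginv; apply: ArrowStep.
Qed.

End LocalArrows.

(** * Models of the nerve *)

(** What a simplicial set [K] must satisfy in dimensions 0, 1 and 2 for its edge
    group to be computed by words in the local arrows of [B]: its points are
    those of [B], its edges are local arrows up to the structural functors, and
    its triangles are exactly the composable pairs inside one local groupoid. *)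
Record nerve_model (X : Type) (B : atlas X) (K : sset) (vert : X -> simp K 0)
    (E : local_arrow B -> simp K 1) : Prop := NerveModel {
  nm_vert_inj : injective vert;
  nm_vert_surj : forall u, exists x, vert x = u;
  nm_src : forall g, d1 (E g) = vert (la_src g);
  nm_tgt : forall g, d0 (E g) = vert (la_tgt g);
  nm_gid : forall a x (ax : obj B a x), E (id_arrow ax) = degen ord0 (vert x);
  nm_eq : forall g g', E g = E g' <-> eqv (@arrow_step X B) g g';
  nm_surj : forall e, exists g, E g = e;
  nm_gcomp : forall a x y z (g : hom B a x y) (h : hom B a y z),
    exists t : simp K 2, [/\ face ord_max t = E (LocalArrow g),
      face ord0 t = E (LocalArrow h)
      & face (lift ord0 ord0) t = E (LocalArrow (gcomp g h))];
  nm_tri : forall t : simp K 2, exists a x y z (g : hom B a x y)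
    (h : hom B a y z), [/\ face ord_max t = E (LocalArrow g),
      face ord0 t = E (LocalArrow h)
      & face (lift ord0 ord0) t = E (LocalArrow (gcomp g h))]
}.

(** * Words as edge loops *)

Section EdgeClass.
Variables (K : sset) (v : simp K 0).
Implicit Types (s t : seq (oedge K)).

(** A total function on sequences of edges, with a junk value on those that are
    not loops; classes can then be rewritten without carrying path proofs. *)
Definition edge_cls s : edge_group v :=
  if pselect (is_epath v s v) is left p
  then eg_cls (exist (fun s => is_epath v s v) s p) else eg_one v.

Lemma edge_clsE s (p : is_epath v s v) : edge_cls s = eg_cls (exist _ s p).
Proof.
rewrite /edge_cls; case: pselect => // q.
by congr eg_cls; apply: eloop_inj.
Qed.

Lemma edge_cls_proj (p : eloop v) : edge_cls (proj1_sig p) = eg_cls p.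
Proof. by case: p => s p; rewrite edge_clsE. Qed.

Lemma edge_cls_move s1 s2 t1 t2 : emove t1 t2 ->
  is_epath v (s1 ++ t1 ++ s2) v -> is_epath v (s1 ++ t2 ++ s2) v ->
  edge_cls (s1 ++ t1 ++ s2) = edge_cls (s1 ++ t2 ++ s2).
Proof.
move=> m p q; rewrite (edge_clsE p) (edge_clsE q); apply/cls_eqv/rst_step.
by exists s1, s2, t1, t2.
Qed.

Lemma edge_cls_cat s t : is_epath v s v -> is_epath v t v ->
  edge_cls (s ++ t) = (edge_cls s * edge_cls t)%g.
Proof.
move=> p q; have pq : is_epath v (s ++ t) v by apply/is_epath_cat; exists v.
rewrite (edge_clsE p) (edge_clsE q) (edge_clsE pq).
apply: esym; rewrite [LHS]eg_mulE.
by congr eg_cls; apply: eloop_inj.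
Qed.

End EdgeClass.

Section Words.
Variables (X : Type) (B : atlas X) (K : sset) (vert : X -> simp K 0).
Variables (E : local_arrow B -> simp K 1) (M : nerve_model vert E) (x : X).
Implicit Types (y z : X) (g h : local_arrow B) (s t : seq (local_arrow B)).

Local Notation v := (vert x).

Definition nerve_path s : seq (oedge K) := [seq (E g, true) | g <- s].

Definition word_class s : edge_group v := edge_cls v (nerve_path s).

Lemma nerve_path_epath y s z :
  is_word y s z -> is_epath (vert y) (nerve_path s) (vert z).
Proof.
elim: s y => [|g s IH] y /= => [-> // | [gy /IH]].
by rewrite /osrc /otgt /= (nm_src M) (nm_tgt M) gy.
Qed.

Lemma d1_degen (u : simp K 0) : d1 (degen ord0 u) = u.
Proof. by apply: face_degen_eq; right. Qed.

Lemma d0_degen (u : simp K 0) : d0 (degen ord0 u) = u.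
Proof. by apply: face_degen_eq; left. Qed.

Lemma degen_ends y g : E g = degen ord0 (vert y) ->
  la_src g = y /\ la_tgt g = y.
Proof.
move=> e; split; apply: (nm_vert_inj M).
- by rewrite -(nm_src M) e d1_degen.
- by rewrite -(nm_tgt M) e d0_degen.
Qed.

Lemma word_class_degen s1 s2 y g : E g = degen ord0 (vert y) ->
  is_word x (s1 ++ g :: s2) x ->
  word_class (s1 ++ g :: s2) = word_class (s1 ++ s2).
Proof.
move=> e p; have [gs gt] := degen_ends e.
have q : is_word x (s1 ++ s2) x.
  move: p => /is_word_cat[m p1 /= [eg p2]]; apply/is_word_cat; exists m => //.
  by rewrite -eg gs -gt.
move/nerve_path_epath: p; move/nerve_path_epath: q.
rewrite /word_class /nerve_path !map_cat /= e => q p.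
exact: (@edge_cls_move K v _ _ [:: (degen ord0 (vert y), true)] [::]
  (EDegen _) p q).
Qed.

Lemma word_class_gcomp s1 s2 a y z w (g : hom B a y z) (h : hom B a z w) :
  is_word x (s1 ++ [:: LocalArrow g, LocalArrow h & s2]) x ->
  word_class (s1 ++ [:: LocalArrow g, LocalArrow h & s2])
    = word_class (s1 ++ LocalArrow (gcomp g h) :: s2).
Proof.
move=> p; have q : is_word x (s1 ++ LocalArrow (gcomp g h) :: s2) x.
  move: p => /is_word_cat[m p1 /= [eg [_ p2]]].
  by apply/is_word_cat; exists m.
have [t [t2 t0 t1]] := nm_gcomp M g h.
move/nerve_path_epath: p; move/nerve_path_epath: q.
rewrite /word_class /nerve_path !map_cat /= -t2 -t0 -t1 => q p.
exact: (@edge_cls_move K v _ _ _ _ (ETriangle t) p q).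
Qed.

(** An edge traversed backwards is the inverse arrow traversed forwards: insert
    after it [g] followed by [ginv g], whose composite is degenerate, then
    cancel the backward edge against [g]. *)
Lemma edge_cls_reversed (s1 s2 : seq (oedge K)) g :
  is_epath v (s1 ++ (E g, false) :: s2) v ->
  is_epath v (s1 ++ (E (inv_arrow g), true) :: s2) v /\
  edge_cls v (s1 ++ (E g, false) :: s2)
    = edge_cls v (s1 ++ (E (inv_arrow g), true) :: s2).
Proof.
case: g => a y z g.
set e := E _; set e' := E _ => p.
have ey : osrc (e, false) = vert z by rewrite /osrc /= (nm_tgt M).
have ez : otgt (e, false) = vert y by rewrite /otgt /= (nm_src M).
have fy : osrc (e', true) = vert z by rewrite /osrc /= (nm_src M).
have fz : otgt (e', true) = vert y by rewrite /otgt /= (nm_tgt M).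
have gy : osrc (e, true) = vert y by rewrite /osrc /= (nm_src M).
have gz : otgt (e, true) = vert z by rewrite /otgt /= (nm_tgt M).
have /is_epath_cat[m p1 /= [em p2]] := p.
rewrite ey in em; rewrite ez in p2; subst m.
have q : is_epath v (s1 ++ (e', true) :: s2) v.
  by apply/is_epath_cat; exists (vert z) => //=; rewrite fz.
split=> //.
have r : is_epath v (s1 ++ [:: (e, false); (e, true); (e', true)] ++ s2) v.
  apply/is_epath_cat; exists (vert z) => //.
  by rewrite /= ez gy gz fy fz.
have rq := @edge_cls_move K v s1 ((e', true) :: s2) _ _ (EBack (e, false)) r q.
rewrite -rq.
have [t [t2 t0 t1]] := nm_gcomp M g (ginv g).
rewrite /= (gcompVr (gsrc g)) in t1.
have t1' : face (lift ord0 ord0) t = degen ord0 (vert y).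
  by rewrite t1 -(nm_gid M (gsrc g)).
have r' : is_epath v ((s1 ++ [:: (e, false)])
    ++ [:: (face (lift ord0 ord0) t, true)] ++ s2) v.
  rewrite -catA; apply/is_epath_cat; exists (vert z) => //=; rewrite ez.
  by rewrite /osrc /otgt /= t1' d1_degen d0_degen.
have mv : emove [:: (e, true); (e', true)] [:: (face (lift ord0 ord0) t, true)].
  by have := ETriangle t; rewrite t2 t0.
have m1 := @edge_cls_move K v (s1 ++ [:: (e, false)]) s2 _ _ mv _ r'.
rewrite t1' in r' m1.
have m2 := @edge_cls_move K v (s1 ++ [:: (e, false)]) s2 _ _ (EDegen _) r' _.
rewrite -!catA /= in m1 m2.
by rewrite [RHS]m1 // m2.
Qed.

Definition rep_arrow (e : simp K 1) : local_arrow B :=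
  projT1 (cid (nm_surj M e)).

Lemma rep_arrowK e : E (rep_arrow e) = e.
Proof. by rewrite /rep_arrow; case: cid. Qed.

(** Only inverses in the local groupoids make it possible to read an arbitrary
    edge loop, with its edges traversed backwards, as a word. *)
Definition lift_edge (a : oedge K) : local_arrow B :=
  if a.2 then rep_arrow a.1 else inv_arrow (rep_arrow a.1).

Definition lift_path (s : seq (oedge K)) := [seq lift_edge a | a <- s].

Lemma lift_edge_ends a :
  osrc a = vert (la_src (lift_edge a)) /\ otgt a = vert (la_tgt (lift_edge a)).
Proof.
case: a => e [] /=; rewrite /osrc /otgt /= -{1 3}(rep_arrowK e);
  by rewrite (nm_src M) (nm_tgt M).
Qed.

Lemma lift_path_word y (s : seq (oedge K)) z :
  is_epath (vert y) s (vert z) -> is_word y (lift_path s) z.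
Proof.
elim: s y => [|a s IH] y /= => [/(nm_vert_inj M) // |].
have [-> ->] := lift_edge_ends a; case=> /(nm_vert_inj M) ->.
by move/IH.
Qed.

Lemma word_class_lift_path (s : seq (oedge K)) :
  is_epath v s v -> word_class (lift_path s) = edge_cls v s.
Proof.
rewrite -{1 3}[s]cat0s /word_class -[nerve_path _]cat0s.
elim: s [::] => [|[e b] s IH] s1 //= p.
have [q ->] : is_epath v (s1 ++ (E (lift_edge (e, b)), true) :: s) v
    /\ edge_cls v (s1 ++ (e, b) :: s)
       = edge_cls v (s1 ++ (E (lift_edge (e, b)), true) :: s).
  case: b p => p; rewrite /lift_edge /=; first by rewrite rep_arrowK.
  by rewrite -{2}(rep_arrowK e); apply: edge_cls_reversed; rewrite rep_arrowK.
by rewrite -cat_rcons in q *; rewrite -cat_rcons IH.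
Qed.

End Words.

(** * Reading a morphism from the line as a word *)

Section Windows.
Variables (X : Type) (B : atlas X) (K : sset) (vert : X -> simp K 0).
Variables (E : local_arrow B -> simp K 1) (M : nerve_model vert E) (x : X).
Implicit Types (l : mor line B).

Local Notation v := (vert x).
Local Notation word_class := (@word_class X B K vert E x).

Definition window l (N : int) (k : nat) : seq (local_arrow B) :=
  [seq arrow_at l (N + i%:Z)%R | i <- iota 0 k].

Lemma window_cat l N i j : window l N (i + j) =
  window l N i ++ window l (N + i%:Z)%R j.
Proof.
rewrite /window iotaD map_cat add0n -{2}[i]addn0 iotaDl -map_comp.
by congr cat; apply: eq_map => n /=; congr arrow_at; lia.
Qed.

Lemma window_word l N k :
  is_word (mfun l N) (window l N k) (mfun l (N + k%:Z)%R).
Proof.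
elim: k => [|k IH]; first by rewrite GRing.addr0.
rewrite -addn1 window_cat; apply/is_word_cat; eexists; first exact: IH.
by rewrite /= GRing.addr0; split=> //; congr mfun; lia.
Qed.

Lemma tri_arrow_at l l' n :
  tri l l' -> arrow_step (arrow_at l n) (arrow_at l' n).
Proof.
move=> /(_ (LE n)) [h /(_ _ _ (line_edge n))[bx [by_]]].
by rewrite /arrow_at /marrow => <-; apply: ArrowStep.
Qed.

(** The edges of the nerve along a path depend on its class only. *)
Lemma mcls_arrow_at l l' n : mcls l = mcls l' ->
  E (arrow_at l n) = E (arrow_at l' n).
Proof.
move=> ll'; have e := cls_eqvP ll'; apply: (proj2 (nm_eq M _ _)).
apply: (eqv_map (f := fun l => arrow_at l n)) e => a b ab.
by apply: rst_step; apply: tri_arrow_at.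
Qed.

(** The nerve edges of [l] are degenerate at [x] outside [[N, N + k)].  This is
    weaker than stabilization, and unlike it invariant under [tri], which may
    change the local groupoids in which the identities are taken. *)
Definition supported l (N : int) (k : nat) : Prop :=
  forall n : int, (n < N)%R \/ (N + k%:Z <= n)%R ->
    E (arrow_at l n) = degen ord0 v.

Lemma supported_mfun l N k : supported l N k ->
  mfun l N = x /\ mfun l (N + k%:Z)%R = x.
Proof.
move=> s; split.
  have [] := degen_ends M (s (N - 1)%R _); first by left; lia.
  by move=> _ /= <-; congr mfun; lia.
have [] := degen_ends M (s (N + k%:Z)%R _) => //; by right.
Qed.

Lemma supported_word l N k : supported l N k -> is_word x (window l N k) x.
Proof.
by move=> /supported_mfun[e1 e2]; have := window_word l N k; rewrite e1 e2.
Qed.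

Lemma supported_ext l N k i j : supported l N k ->
  supported l (N - i%:Z)%R (i + k + j).
Proof. by move=> s n nN; apply: s; lia. Qed.

Arguments supported_ext {l N k} i j _ _ _.

Lemma word_class_extl l N k i : supported l N k ->
  word_class (window l (N - i%:Z)%R (i + k)) = word_class (window l N k).
Proof.
move=> s; elim: i => [|i IH]; first by rewrite GRing.subr0.
have s' := supported_ext i.+1 0 s; rewrite addn0 in s'.
have e : window l (N - i.+1%:Z)%R (i.+1 + k)
    = arrow_at l (N - i.+1%:Z)%R :: window l (N - i%:Z)%R (i + k).
  rewrite addSn -[(i + k).+1]add1n [LHS]window_cat {1}/window [map _ _]/= cat1s.
  by congr (arrow_at _ _ :: window _ _ _); lia.
have := supported_word s'; rewrite -IH e => w.
by rewrite (@word_class_degen _ _ _ _ _ M x [::] _ x) //; apply: s; lia.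
Qed.

Lemma word_class_extr l N k j : supported l N k ->
  word_class (window l N (k + j)) = word_class (window l N k).
Proof.
move=> s; elim: j => [|j IH]; first by rewrite addn0.
have s' := supported_ext 0 j.+1 s; rewrite add0n GRing.subr0 in s'.
have := supported_word s'; rewrite -IH addnS -[(k + j).+1]addn1 window_cat.
rewrite [window _ (_ + _)%R _]/=.
move=> w; rewrite (@word_class_degen _ _ _ _ _ M x _ _ x) ?cats0 //.
by apply: s; lia.
Qed.

Lemma word_class_ext l N k i j : supported l N k ->
  word_class (window l (N - i%:Z)%R (i + k + j)) = word_class (window l N k).
Proof.
move=> s; rewrite -(word_class_extl i s); apply: word_class_extr.
by have := supported_ext i 0 s; rewrite addn0.
Qed.

(** The class read in a window that contains the support does not depend on the
    window: both windows are enlarged to the same one, which inserts degenerate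
    edges only. *)
Lemma word_class_window l N k N' k' : supported l N k -> supported l N' k' ->
  word_class (window l N k) = word_class (window l N' k').
Proof.
move=> s s'.
pose d := `|(N - N')%R|%N.
rewrite -(word_class_ext d (d + k') s).
rewrite -(word_class_ext `|(N' - N + d%:Z)%R|%N
  (`|(N - N' + d%:Z)%R|%N + k) s').
by congr word_class; congr window; rewrite /d; lia.
Qed.

End Windows.

(** * Morphisms out of the line and of the plane *)

Section LineFunctors.
Variables (X : Type) (B : atlas X) (alpha : X -> idx B).
Hypothesis alphaP : forall x, initial x (alpha x).

Definition subcell (s t : line_idx) : Prop :=
  (line_set s `<=` line_set t)%classic.

Lemma subcellP s t : subcell s t -> s = t \/
  exists m n, [/\ s = LV m, t = LE n & line_set t m].
Proof.
case: s t => [m|m] [n|n] st.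
- by left; rewrite (st m erefl).
- by right; exists m, n; split=> //; apply: st.
- have /= := st m (or_introl erefl); have /= := st (m + 1)%R (or_intror erefl).
  lia.
- have := st m (or_introl erefl); have := st (m + 1)%R (or_intror erefl).
  by move=> /= h1 h2; left; congr LE; lia.
Qed.

Lemma gidempotent (G : groupoid X) x (o : gobj G x) (e : ghom G x x) :
  gcomp e e = e -> e = gid o.
Proof.
by move=> ee; rewrite -(gcompVl o e) -{3}ee gcompA (gcompVl o) gcomp1l.
Qed.

(** A morphism from the line with a prescribed map [V] on points.  Keeping [V]
    outside the record lets the rows and the columns of a grid share their
    points definitionally. *)
Record line_functor (V : int -> X) := LineFunctor {
  lidx : line_idx -> idx B;
  lle : forall s t, subcell s t -> le (lidx s) (lidx t);
  lobj : forall s u, line_set s u -> obj B (lidx s) (V u);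
  lhom : forall s u w, line_set s u -> line_set s w ->
    hom B (lidx s) (V u) (V w);
  lhom_comp : forall s u w z (ou ou' : line_set s u) (ow ow' : line_set s w)
    (oz oz' : line_set s z), gcomp (lhom ou ow) (lhom ow' oz) = lhom ou' oz';
  lhom_phi : forall s t (st : subcell s t) u w
    (ou : line_set s u) (ow : line_set s w) (ou' : line_set t u)
    (ow' : line_set t w) bu bw,
    phi (lle st) bu bw (lhom ou ow) = lhom ou' ow'
}.

Lemma lhom_id V (F : line_functor V) s u (o o' : line_set s u) b :
  lhom F o o' = gid b.
Proof.
rewrite (Prop_irrelevance o' o); apply: gidempotent; exact: lhom_comp.
Qed.

Definition mor_of_line_functor V (F : line_functor V) : mor line B.
Proof.
refine (@Mor _ _ line B V (lidx F) (lle F)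
  (fun s u o => lobj F o) (fun s u w k => lhom F (proj1 k) (proj2 k)) _ _ _).
- by move=> s u o; apply: lhom_id.
- by move=> s u w z k l; apply: esym; apply: lhom_comp.
- by move=> s t h u w bu bw k; apply: esym; apply: lhom_phi.
Defined.

Section Build.
Variables (V : int -> X) (b : int -> idx B).
Variable g : forall m, hom B (b m) (V m) (V (m + 1)%R).

Definition cell_idx (s : line_idx) : idx B :=
  match s with LV m => alpha (V m) | LE m => b m end.

Definition cell_base (s : line_idx) : int :=
  match s with LV m => m | LE m => m end.

Lemma edge_end m u : line_set (LE m) u -> u <> m -> u = (m + 1)%R.
Proof. by case. Qed.

(** An element of [{m, m + 1}] known only through a proposition has to be used
    to build an arrow, so the case distinction is made by deciding [u = m]. *)
Definition edge_elim m (P : int -> Type) (p0 : P m) (p1 : P (m + 1)%R) u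
    (o : line_set (LE m) u) : P u :=
  match @eqP _ u m with
  | ReflectT e => eq_rect_r P p0 e
  | ReflectF ne => eq_rect_r P p1 (edge_end o ne)
  end.

Lemma edge_elim0 m P p0 p1 o : @edge_elim m P p0 p1 m o = p0.
Proof.
rewrite /edge_elim; case: eqP => // e.
by rewrite (Prop_irrelevance e erefl).
Qed.

Lemma edge_elim1 m P p0 p1 o : @edge_elim m P p0 p1 (m + 1)%R o = p1.
Proof.
rewrite /edge_elim; case: eqP => e; first by exfalso; lia.
by rewrite (Prop_irrelevance (edge_end o e) erefl).
Qed.

(** A functor on an indiscrete groupoid is determined by its arrows out of a
    base point, and any such choice of arrows is allowed; functoriality of
    [edge_functor] is then automatic. *)
Definition potential (s : line_idx) : forall u, line_set s u ->
    hom B (cell_idx s) (V (cell_base s)) (V u) :=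
  match s return forall u, line_set s u ->
    hom B (cell_idx s) (V (cell_base s)) (V u) with
  | LV m => fun u (o : u = m) => eq_rect_r
      (fun u => hom B (alpha (V m)) (V m) (V u)) (gid (proj1 (alphaP (V m)))) o
  | LE m => @edge_elim m (fun u => hom B (b m) (V m) (V u)) (gid (gsrc (g m)))
      (g m)
  end.

Lemma alpha_le x c : obj B c x -> le (alpha x) c.
Proof. exact: (proj2 (alphaP x)). Qed.

Lemma cell_le s t : subcell s t -> le (cell_idx s) (cell_idx t).
Proof.
case/subcellP => [->|[m [n [-> -> /= mn]]]]; first exact: le_refl.
apply: alpha_le; case: mn => ->; [exact: gsrc (g n) | exact: gtgt (g n)].
Qed.

(** With initial indices at the integers, any sequence of composable local
    arrows is a morphism from the line: the only comparisons required are those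
    of an initial index with the index of an adjacent arrow. *)
Definition edge_functor : line_functor V.
Proof.
refine (@LineFunctor V cell_idx cell_le (fun s u o => gtgt (potential o))
  (fun s u w ou ow => gcomp (ginv (potential ou)) (potential ow)) _ _).
- move=> s u w z ou ou' ow ow' oz oz'.
  rewrite (Prop_irrelevance ou' ou) (Prop_irrelevance ow' ow).
  rewrite (Prop_irrelevance oz' oz) gcompA -[gcomp (gcomp _ _) (ginv _)]gcompA.
  by rewrite (gcompVr (gsrc (potential ow))) (gcomp1r (gsrc (potential ow))).
- move=> s t st u w ou ow ou' ow' bu bw.
  case: (subcellP st) => [e|[m [n [es et mn]]]].
    subst t; rewrite (Prop_irrelevance ou' ou) (Prop_irrelevance ow' ow).
    by rewrite phi_refl.
  subst s t; have eu : u = m := ou; have ew : w = m := ow; subst u w.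
  rewrite (Prop_irrelevance ow ou) (Prop_irrelevance ow' ou').
  rewrite (Prop_irrelevance bw bu).
  rewrite (gcompVl (gtgt (potential ou))) (gcompVl (gtgt (potential ou'))).
  rewrite phi_gid; congr gid; exact: Prop_irrelevance.
Defined.

Lemma edge_functor_edge m o0 o1 :
  @lhom _ edge_functor (LE m) m (m + 1)%R o0 o1 = g m.
Proof.
by rewrite /= edge_elim0 edge_elim1 gidV gcomp1l.
Qed.

End Build.

Lemma phi_irr a b (h h' : le a b) x y (bx bx' : obj B b x)
    (by_ by_' : obj B b y) (g : hom B a x y) :
  phi h bx by_ g = phi h' bx' by_' g.
Proof.
by rewrite (Prop_irrelevance h h') (Prop_irrelevance bx bx')
  (Prop_irrelevance by_ by_').
Qed.

(** A morphism on the plane from its rows [F], its columns [C] and the indices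
    [d] of its cells.  The arrow from [(u, w)] to [(u', w')] first follows the
    row [w], then the column [u']; [comm] says that the other order gives the
    same arrow, and this is all that functoriality needs. *)
Section Grid.
Variables (V : int -> int -> X).
Variables (F : forall n, line_functor (fun m => V m n)).
Variables (C : forall m, line_functor (V m)).
Variables (d : line_idx -> line_idx -> idx B).
Hypothesis dF : forall s s' t' w, subcell s s' -> line_set t' w ->
  le (lidx (F w) s) (d s' t').
Hypothesis dC : forall s' t t' u, subcell t t' -> line_set s' u ->
  le (lidx (C u) t) (d s' t').
Hypothesis dd : forall s s' t t', subcell s s' -> subcell t t' ->
  le (d s t) (d s' t').
Hypothesis dobj : forall s t u w, line_set s u -> line_set t w ->
  obj B (d s t) (V u w).

Lemma subcell_refl s : subcell s s.
Proof. exact: (@subset_refl _ (line_set s)). Qed.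

Arguments subcell_refl s : clear implicits.

Definition across s t u u' w (ou : line_set s u) (ou' : line_set s u')
    (ow : line_set t w) : hom B (d s t) (V u w) (V u' w) :=
  phi (dF (subcell_refl s) ow) (dobj ou ow) (dobj ou' ow) (lhom (F w) ou ou').

Definition along s t u w w' (ou : line_set s u) (ow : line_set t w)
    (ow' : line_set t w') : hom B (d s t) (V u w) (V u w') :=
  phi (dC (subcell_refl t) ou) (dobj ou ow) (dobj ou ow') (lhom (C u) ow ow').

Hypothesis comm : forall s t u u' w w' (ou : line_set s u) (ou' : line_set s u')
    (ow : line_set t w) (ow' : line_set t w'),
  gcomp (across ou ou' ow) (along ou' ow ow')
    = gcomp (along ou ow ow') (across ou ou' ow').

Lemma across_id s t u w (ou ou' : line_set s u) (ow : line_set t w) o :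
  across ou ou' ow = gid o.
Proof.
rewrite /across (lhom_id _ _ (lobj (F w) ou)).
rewrite (Prop_irrelevance (dobj ou' ow) (dobj ou ow)) phi_gid.
by congr gid; apply: Prop_irrelevance.
Qed.

Lemma along_id s t u w (ou : line_set s u) (ow ow' : line_set t w) o :
  along ou ow ow' = gid o.
Proof.
rewrite /along (lhom_id _ _ (lobj (C u) ow)).
rewrite (Prop_irrelevance (dobj ou ow') (dobj ou ow)) phi_gid.
by congr gid; apply: Prop_irrelevance.
Qed.

Lemma across_comp s t u u' u'' w (ou : line_set s u) (ou' : line_set s u')
    (ou'' : line_set s u'') (ow : line_set t w) :
  gcomp (across ou ou' ow) (across ou' ou'' ow) = across ou ou'' ow.
Proof. by rewrite -phi_gcomp (lhom_comp _ _ ou _ _ _ ou''). Qed.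

Lemma along_comp s t u w w' w'' (ou : line_set s u) (ow : line_set t w)
    (ow' : line_set t w') (ow'' : line_set t w'') :
  gcomp (along ou ow ow') (along ou ow' ow'') = along ou ow ow''.
Proof. by rewrite -phi_gcomp (lhom_comp _ _ ow _ _ _ ow''). Qed.

Lemma across_phi s t s' t' (ss : subcell s s') (tt : subcell t t') u u' w
    (ou : line_set s u) (ou' : line_set s u') (ow : line_set t w)
    (pu : line_set s' u) (pu' : line_set s' u') (pw : line_set t' w) b b' :
  phi (dd ss tt) b b' (across ou ou' ow) = across pu pu' pw.
Proof.
rewrite /across -(lhom_phi ss ou ou' pu pu' (lobj _ pu) (lobj _ pu')).
rewrite !(phi_trans _ _ (dF ss pw)).
by congr phi; apply: Prop_irrelevance.
Qed.

Lemma along_phi s t s' t' (ss : subcell s s') (tt : subcell t t') u w w'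
    (ou : line_set s u) (ow : line_set t w) (ow' : line_set t w')
    (pu : line_set s' u) (pw : line_set t' w) (pw' : line_set t' w') b b' :
  phi (dd ss tt) b b' (along ou ow ow') = along pu pw pw'.
Proof.
rewrite /along -(lhom_phi tt ow ow' pw pw' (lobj _ pw) (lobj _ pw')).
rewrite !(phi_trans _ _ (dC tt pu)).
by congr phi; apply: Prop_irrelevance.
Qed.

Definition grid_mor : mor (prod_atlas line line) B.
Proof.
refine (@Mor _ _ (prod_atlas line line) B (fun p => V p.1 p.2)
  (fun c => d c.1 c.2) (fun c c' h => dd (proj1 h) (proj2 h))
  (fun c p o => dobj (proj1 o) (proj2 o))
  (fun c p q k => gcomp (across (proj1 k.1) (proj2 k.1) (proj1 k.2))
                        (along (proj2 k.1) (proj1 k.2) (proj2 k.2))) _ _ _).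
- move=> c p o; rewrite (across_id _ _ _ (dobj (proj1 o) (proj2 o))).
  by rewrite gcomp1l; apply: along_id.
- move=> c p q r k l.
  rewrite (Prop_irrelevance (proj1 l.1) (proj2 k.1)).
  rewrite (Prop_irrelevance (proj1 l.2) (proj2 k.2)) /=.
  rewrite -gcompA [gcomp (along _ _ _) (gcomp _ _)]gcompA -comm -gcompA gcompA.
  rewrite across_comp along_comp.
  by congr gcomp; [congr across|congr along]; apply: Prop_irrelevance.
- move=> c c' h p q bp bq k /=.
  have oqp : obj B (d c'.1 c'.2) (V q.1 p.2).
    by apply: dobj; [exact: proj1 bq|exact: proj2 bp].
  rewrite (phi_gcomp _ _ oqp).
  rewrite (across_phi _ _ _ _ _ (proj1 bp) (proj1 bq) (proj2 bp)).
  rewrite (along_phi _ _ _ _ _ (proj1 bq) (proj2 bp) (proj2 bq)).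
  by congr gcomp; [congr across|congr along]; apply: Prop_irrelevance.
Defined.

End Grid.

(** The constant value of all rows and grids outside a finite window.  A
    homotopy must be equal to one identity in one local groupoid near the ends
    of the strip, hence the choice of a fixed index. *)
Definition initial_id x : local_arrow B := id_arrow (proj1 (alphaP x)).

Lemma initial_id_gcomp x a y z w (g : hom B a y z) (h : hom B a z w) :
  LocalArrow g = initial_id x -> LocalArrow h = initial_id x ->
  LocalArrow (gcomp g h) = initial_id x.
Proof.
move=> eg eh; case: (LocalArrow_ends eg) => ? ? ?; subst.
case: (LocalArrow_ends eh) => _ _ ?; subst.
by rewrite (LocalArrow_inj eg) (LocalArrow_inj eh) gcomp1l.
Qed.

Lemma initial_id_ginv x a y z (g : hom B a y z) :
  LocalArrow g = initial_id x -> LocalArrow (ginv g) = initial_id x.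
Proof.
move=> eg; case: (LocalArrow_ends eg) => ? ? ?; subst.
by rewrite (LocalArrow_inj eg) gidV.
Qed.

Lemma initial_id_phi x a c (h : le a c) y z (g : hom B a y z) by_ bz :
  c = alpha x -> LocalArrow g = initial_id x ->
  LocalArrow (phi h by_ bz g) = initial_id x.
Proof.
move=> ec eg; case: (LocalArrow_ends eg) => ? ? ?; subst.
by rewrite phi_refl.
Qed.

Lemma initial_id_gid x y (o : obj B (alpha x) y) : y = x ->
  LocalArrow (gid o) = initial_id x.
Proof. by move=> e; subst y; apply: id_arrow_irr. Qed.

Lemma edge_functor_LV V b g x m u w ou ow : V m = x ->
  LocalArrow (@lhom V (@edge_functor V b g) (LV m) u w ou ow) = initial_id x.
Proof.
move=> e; have eu : u = m := ou; have ew : w = m := ow; subst u w x.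
rewrite (@lhom_id _ (edge_functor g) _ _ ou ow (proj1 (alphaP (V m)))).
exact: initial_id_gid.
Qed.

Lemma edge_functor_LE V b g x m u w ou ow : LocalArrow (g m) = initial_id x ->
  LocalArrow (@lhom V (@edge_functor V b g) (LE m) u w ou ow) = initial_id x.
Proof.
move=> e; suff H z (oz : line_set (LE m) z) :
    LocalArrow (@potential V b g (LE m) z oz) = initial_id x.
  by apply: initial_id_gcomp; [apply: initial_id_ginv|]; apply: H.
move: (oz) => /= [] ez; subst z; rewrite ?edge_elim0 ?edge_elim1 //.
case: (LocalArrow_ends e) => eb ex _; subst x.
by move: (gsrc (g m)); rewrite eb => o; apply: initial_id_gid.
Qed.

(** The four sides may live in different local groupoids; the square commutes
    after they have been pushed into the one of index [d]. *)
Inductive square (d : idx B) :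
    local_arrow B -> local_arrow B -> local_arrow B -> local_arrow B -> Prop :=
| Square x y x' y' (a : hom B d x y) (c' : hom B d y y') (c : hom B d x x')
    (a' : hom B d x' y') g k' k g' of gcomp a c' = gcomp c a'
    & arrow_step g (LocalArrow a) & arrow_step k' (LocalArrow c')
    & arrow_step k (LocalArrow c) & arrow_step g' (LocalArrow a') :
  square d g k' k g'.

Lemma squareP d i j k l x y x' y' (a : hom B i x y) (c' : hom B j y y')
    (c : hom B k x x') (a' : hom B l x' y') :
  square d (LocalArrow a) (LocalArrow c') (LocalArrow c) (LocalArrow a') ->
  [/\ obj B d x, obj B d y, obj B d x', obj B d y' &
  exists (hi : le i d) (hj : le j d) (hk : le k d) (hl : le l d),
  forall (ox : obj B d x) (oy : obj B d y) (ox' : obj B d x')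
    (oy' : obj B d y'),
    gcomp (phi hi ox oy a) (phi hj oy oy' c')
      = gcomp (phi hk ox ox' c) (phi hl ox' oy' a')].
Proof.
have H g h m n : square d g h m n -> g = LocalArrow a -> h = LocalArrow c' ->
    m = LocalArrow c -> n = LocalArrow a' ->
  [/\ obj B d x, obj B d y, obj B d x', obj B d y' &
  exists (hi : le i d) (hj : le j d) (hk : le k d) (hl : le l d),
  forall (ox : obj B d x) (oy : obj B d y) (ox' : obj B d x')
    (oy' : obj B d y'),
    gcomp (phi hi ox oy a) (phi hj oy oy' c')
      = gcomp (phi hk ox ox' c) (phi hl ox' oy' a')]; last first.
  by move=> sq; apply: H sq erefl erefl erefl erefl.
case=> p q p' q' a0 c0' c0 a0' g1 k1' k1 g1' e sa sc' sc sa' ? ? ? ?.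
subst g1 k1' k1 g1'.
have [? ? [hi ei]] := arrow_stepP sa.
have [_ ? [hj ej]] := arrow_stepP sc'; subst.
have [_ ? [hk ek]] := arrow_stepP sc.
have [_ _ [hl el]] := arrow_stepP sa'; subst.
split; [exact: gsrc a0|exact: gtgt a0|exact: gtgt c0|exact: gtgt a0'|].
exists hi, hj, hk, hl => ox oy ox' oy'.
rewrite (LocalArrow_inj (ei ox oy)) (LocalArrow_inj (ej oy oy')).
by rewrite (LocalArrow_inj (ek ox ox')) (LocalArrow_inj (el ox' oy')).
Qed.

Lemma swap_inverse (G : groupoid X) x y x' y' (a : ghom G x y) (b : ghom G y x)
    (a' : ghom G x' y') (b' : ghom G y' x') (c : ghom G x x') (c' : ghom G y y')
    (oy : gobj G y) (ox' : gobj G x') :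
  gcomp b a = gid oy -> gcomp a' b' = gid ox' ->
  gcomp a c' = gcomp c a' -> gcomp b c = gcomp c' b'.
Proof.
move=> ba ab' ac; rewrite -(gcomp1r ox' c) -ab' [gcomp c _]gcompA -ac.
by rewrite -gcompA gcompA ba gcomp1l.
Qed.

Lemma line_exists (G : int -> local_arrow B) :
  (forall n, la_tgt (G n) = la_src (G (n + 1)%R)) ->
  exists l : mor line B, forall n, arrow_at l n = G n.
Proof.
move=> Gc.
pose g n : hom B (la_idx (G n)) (la_src (G n)) (la_src (G (n + 1)%R)) :=
  as_hom erefl erefl (Gc n).
exists (mor_of_line_functor (edge_functor g)) => n.
rewrite /arrow_at /marrow /= edge_elim0 edge_elim1 gidV gcomp1l.
exact: as_homK.
Qed.

(** A grid of local arrows whose unit squares commute, [G n m] being the [m]-th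
    arrow of row [n] and [K n m] the vertical arrow from row [n] to the next one
    at [m], extends to a morphism on the plane. *)
Section GridOfArrows.
Variables (G K : int -> int -> local_arrow B) (D : int -> int -> idx B).
Hypothesis Gc : forall n m, la_tgt (G n m) = la_src (G n (m + 1)%R).
Hypothesis Ks : forall n m, la_src (K n m) = la_src (G n m).
Hypothesis Kt : forall n m, la_tgt (K n m) = la_src (G (n + 1)%R m).
Hypothesis sq : forall n m,
  square (D n m) (G n m) (K n (m + 1)%R) (K n m) (G (n + 1)%R m).

Let V m n := la_src (G n m).

Let gG n m : hom B (la_idx (G n m)) (V m n) (V (m + 1)%R n) :=
  as_hom erefl erefl (Gc n m).
Let gK m n : hom B (la_idx (K n m)) (V m n) (V m (n + 1)%R) :=
  as_hom erefl (Ks n m) (Kt n m).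

Let F n : line_functor (fun m => V m n) := edge_functor (gG n).
Let C m : line_functor (V m) := edge_functor (gK m).

Let d s t : idx B :=
  match s, t with
  | LV m, LV n => alpha (V m n)
  | LE m, LV n => la_idx (G n m)
  | LV m, LE n => la_idx (K n m)
  | LE m, LE n => D n m
  end.

Let squareV n m : [/\ obj B (D n m) (V m n), obj B (D n m) (V (m + 1)%R n),
    obj B (D n m) (V m (n + 1)%R), obj B (D n m) (V (m + 1)%R (n + 1)%R) &
  exists (hi : le (la_idx (G n m)) (D n m))
    (hj : le (la_idx (K n (m + 1)%R)) (D n m))
    (hk : le (la_idx (K n m)) (D n m))
    (hl : le (la_idx (G (n + 1)%R m)) (D n m)),
  forall ox oy ox' oy',
    gcomp (phi hi ox oy (gG n m)) (phi hj oy oy' (gK (m + 1)%R n))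
      = gcomp (phi hk ox ox' (gK m n)) (phi hl ox' oy' (gG (n + 1)%R m))].
Proof. by apply: squareP; rewrite !as_homK; apply: sq. Qed.

Let dobj s t u w : line_set s u -> line_set t w -> obj B (d s t) (V u w).
Proof.
have [oG oK] := (fun n m => gsrc (gG n m), fun m n => gsrc (gK m n)).
have [oG' oK'] := (fun n m => gtgt (gG n m), fun m n => gtgt (gK m n)).
case: s t => [m|m] [n|n] /= ou ow.
- by rewrite ou ow; apply: (proj1 (alphaP _)).
- by rewrite ou; case: ow => ->.
- by rewrite ow; case: ou => ->.
- by have [] := squareV n m; case: ou => ->; case: ow => ->.
Qed.

Let dF s s' t' w : subcell s s' -> line_set t' w ->
  le (lidx (F w) s) (d s' t').
Proof.
move=> ss ow; case: s ss => m ss; first exact: alpha_le (dobj (ss m erefl) ow).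
case: (subcellP ss) => [e|[? [? []]] //]; subst s'.
case: t' ow => n /= ow; first by rewrite ow; apply: le_refl.
by have [_ _ _ _ [? [? [? [? _]]]]] := squareV n m; case: ow => ->.
Qed.

Let dC s' t t' u : subcell t t' -> line_set s' u ->
  le (lidx (C u) t) (d s' t').
Proof.
move=> tt ou; case: t tt => n tt; first exact: alpha_le (dobj ou (tt n erefl)).
case: (subcellP tt) => [e|[? [? []]] //]; subst t'.
case: s' ou => m /= ou; first by rewrite ou; apply: le_refl.
by have [_ _ _ _ [? [? [? [? _]]]]] := squareV n m; case: ou => ->.
Qed.

Let dd s s' t t' : subcell s s' -> subcell t t' -> le (d s t) (d s' t').
Proof.
case: s t => [m|m] [n|n] ss tt.
- exact: alpha_le (dobj (ss m erefl) (tt n erefl)).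
- exact: dC tt (ss m erefl).
- exact: dF ss (tt n erefl).
- case: (subcellP ss) => [es|[? [? []]] //]; subst s'.
  by case: (subcellP tt) => [et|[? [? []]] //]; subst t'; apply: le_refl.
Qed.

Let acr := @across V F d dF dobj.
Let alo := @along V C d dC dobj.

Let acrE n m w ou ou' ow (h : le (la_idx (G w m)) (D n m)) o o' :
  acr (s := LE m) (t := LE n) (u := m) (u' := (m + 1)%R) (w := w) ou ou' ow
    = phi h o o' (gG w m).
Proof.
rewrite /acr /across.
rewrite [lhom _ _ _](@edge_functor_edge _ _ (gG w) m ou ou').
exact: phi_irr.
Qed.

Let aloE n m u ou ow ow' (h : le (la_idx (K n u)) (D n m)) o o' :
  alo (s := LE m) (t := LE n) (u := u) (w := n) (w' := (n + 1)%R) ou ow ow'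
    = phi h o o' (gK u n).
Proof.
rewrite /alo /along.
rewrite [lhom _ _ _](@edge_functor_edge _ _ (gK u) n ow ow').
exact: phi_irr.
Qed.

Let commutes s t u u' w w' (ou : line_set s u) (ou' : line_set s u')
    (ow : line_set t w) (ow' : line_set t w') :=
  gcomp (acr ou ou' ow) (alo ou' ow ow')
    = gcomp (alo ou ow ow') (acr ou ou' ow').

Let commutes_base n m (ou : line_set (LE m) m)
    (ou' : line_set (LE m) (m + 1)%R) (ow : line_set (LE n) n)
    (ow' : line_set (LE n) (n + 1)%R) : commutes ou ou' ow ow'.
Proof.
have [o00 o10 o01 o11 [hi [hj [hk [hl e]]]]] := squareV n m.
rewrite /commutes (acrE _ _ _ hi o00 o10) (aloE _ _ _ hj o10 o11).
by rewrite (aloE _ _ _ hk o00 o01) (acrE _ _ _ hl o01 o11).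
Qed.

Let commutes_flip s t u u' w w' (ou : line_set s u) (ou' : line_set s u')
    (ow : line_set t w) (ow' : line_set t w') :
  commutes ou ou' ow ow' -> commutes ou' ou ow ow'.
Proof.
rewrite /commutes; apply: swap_inverse (dobj ou' ow) (dobj ou ow') _ _;
  by rewrite [LHS]across_comp; apply: across_id.
Qed.

Let commutes_turn s t u u' w w' (ou : line_set s u) (ou' : line_set s u')
    (ow : line_set t w) (ow' : line_set t w') :
  commutes ou ou' ow ow' -> commutes ou ou' ow' ow.
Proof.
move=> e; apply: esym; move: (esym e).
apply: swap_inverse (dobj ou ow') (dobj ou' ow) _ _;
  by rewrite [LHS]along_comp; apply: along_id.
Qed.

Let commutes_refl s t u w w' (ou ou' : line_set s u)
    (ow : line_set t w) (ow' : line_set t w') : commutes ou ou' ow ow'.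
Proof.
rewrite /commutes (Prop_irrelevance ou' ou).
have -> : acr ou ou ow = gid (dobj ou ow) by apply: across_id.
have -> : acr ou ou ow' = gid (dobj ou ow') by apply: across_id.
by rewrite gcomp1l gcomp1r.
Qed.

Let commutes_trefl s t u u' w (ou : line_set s u) (ou' : line_set s u')
    (ow ow' : line_set t w) : commutes ou ou' ow ow'.
Proof.
rewrite /commutes (Prop_irrelevance ow' ow).
have -> : alo ou' ow ow = gid (dobj ou' ow) by apply: along_id.
have -> : alo ou ow ow = gid (dobj ou ow) by apply: along_id.
by rewrite gcomp1l gcomp1r.
Qed.

(** Commutation for all pairs of points of a cell follows from the unit square:
    it is stable under reversing either direction and trivial when one of them
    is constant. *)
Let comm s t u u' w w' (ou : line_set s u) (ou' : line_set s u')
    (ow : line_set t w) (ow' : line_set t w') : commutes ou ou' ow ow'.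
Proof.
case: s ou ou' => m ou ou'.
  by have e : u = u' := etrans ou (esym ou'); subst u'; apply: commutes_refl.
case: t ow ow' => n ow ow'.
  by have e : w = w' := etrans ow (esym ow'); subst w'; apply: commutes_trefl.
have H p q (op : line_set (LE m) p) (oq : line_set (LE m) q)
    (o0 : line_set (LE n) n) (o1 : line_set (LE n) (n + 1)%R) :
    commutes op oq o0 o1.
  move: (op) (oq) => /= [] ep [] eq; subst p q; try exact: commutes_refl.
    exact: commutes_base.
  exact/commutes_flip/commutes_base.
move: (ow) (ow') => /= [] ep [] eq; subst w w'; try exact: commutes_trefl.
  exact: H.
exact/commutes_turn/H.
Qed.

Definition grid_of_arrows : mor (prod_atlas line line) B := grid_mor dd comm.

Lemma grid_row m n :
  arrow_at (mcomp (line_incl n) grid_of_arrows) m = G n m.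
Proof.
rewrite /arrow_at /marrow /= (along_id _ _ _ _ _ (gtgt (gG n m))).
rewrite (gcomp1r (gtgt (gG n m))) -[RHS](as_homK erefl erefl (Gc n m)).
rewrite -[as_hom _ _ _]/(gG n m) -(edge_functor_edge (gG n)
  (proj1 (line_edge m)) (proj2 (line_edge m))).
exact: (congr1 (@LocalArrow _ _ _ _ _) (phi_refl _ _ _ _)).
Qed.

Definition const_column x s : Prop :=
  match s with
  | LV m => forall n, K n m = initial_id x
  | LE m => forall n, [/\ G n m = initial_id x, K n m = initial_id x,
                         K n (m + 1)%R = initial_id x & D n m = alpha x]
  end.

Lemma grid_const x s t p q (k : hom (prod_atlas line line) (s, t) p q) :
  const_column x s -> marrow grid_of_arrows k = initial_id x.
Proof.
move=> cs.
have dx : d s t = alpha x.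
  case: s t {k} cs => m [n|n] /= cs; [|by rewrite cs|by have [->] := cs n
    |by have [_ _ _ ->] := cs n].
  by rewrite /V -Ks cs.
apply: initial_id_gcomp; (apply: initial_id_phi; first exact: dx); clear dx.
- case: s k cs => m [[k1 k1'] [k2 k2']] cs; last first.
    by apply: edge_functor_LE; rewrite as_homK; have [-> _ _ _] := cs p.2.
  by apply: edge_functor_LV; rewrite /V -Ks cs.
- have cK n : K n q.1 = initial_id x.
    case: s k cs => m [[k1 k1'] _] cs; first by rewrite k1' cs.
    by have [_ e0 e1 _] := cs n; case: k1' => ->.
  case: t k => n [[k1 k1'] [k2 k2']]; last first.
    by apply: edge_functor_LE; rewrite as_homK cK.
  by apply: edge_functor_LV; rewrite /V -Ks cK.
Qed.

End GridOfArrows.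

End LineFunctors.

(** * Moves between words as homotopies *)

Section RowHomotopies.
Variables (X : Type) (B : atlas X) (alpha : X -> idx B).
Hypothesis alphaP : forall x, initial x (alpha x).
Implicit Types (x y z : X) (g h : local_arrow B) (s t w : seq (local_arrow B)).

Local Notation initial_id := (initial_id alphaP).

Lemma id_arrow_eq a x y (o : obj B a x) (o' : obj B a y) : x = y ->
  id_arrow o = id_arrow o'.
Proof. by move=> e; subst y; apply: id_arrow_irr. Qed.

Lemma mhom_ginv Y Z (A : atlas Y) (C : atlas Z) (f : mor A C) a (x y : Y)
    (k : hom A a x y) : mhom f (ginv k) = ginv (mhom f k).
Proof.
have o := mobj f (gtgt k); have o' := mobj f (gsrc k).
rewrite -[LHS](gcomp1r o') -(gcompVr o' (mhom f k)) gcompA -mhom_gcomp.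
rewrite (gcompVl (gtgt k)) mhom_gid.
by rewrite gcomp1l.
Qed.

(** A morphism with initial indices at the integers is below any morphism whose
    arrows are pushed forward from its own; this is how the rows of the grids
    constructed here are compared with a given path. *)
Lemma tri_of_arrows (f f' : mor line B) :
  (forall m, midx f (LV m) = alpha (mfun f m)) ->
  (forall n, arrow_step (arrow_at f n) (arrow_at f' n)) -> tri f f'.
Proof.
move=> fv fe.
have ff' n : mfun f n = mfun f' n by have [] := arrow_step_ends (fe n).
case=> [m|n].
  have o : obj B (midx f' (LV m)) (mfun f m).
    by rewrite ff'; apply: (mobj f' (a := LV m)).
  have h : le (midx f (LV m)) (midx f' (LV m)).
    by rewrite fv; apply: alpha_le o.
  exists h => x y [ex ey]; have ex' : x = m := ex; have ey' : y = m := ey.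
  subst x y; exists o, o.
  have -> : conj ex ey = gid (ex : obj line (LV m) m).
    exact: (@Prop_irrelevance (_ /\ _)).
  by rewrite !mhom_gid phi_gid; apply: id_arrow_eq.
have [_ _ [h e]] := arrow_stepP (fe n).
exists h => x y k.
have o (z : int) : line_set (LE n) z -> obj B (midx f' (LE n)) (mfun f z).
  by move=> oz; rewrite ff'; apply: (mobj f' (a := LE n)).
exists (o _ (proj1 k)), (o _ (proj2 k)).
have Hid (z : int) (oz oz' : line_set (LE n) z) (l : hom line (LE n) z z) :
    LocalArrow (phi h (o z oz) (o z oz') (mhom f l)) = LocalArrow (mhom f' l).
  have -> : l = gid (oz : obj line (LE n) z).
    exact: (@Prop_irrelevance (_ /\ _)).
  rewrite !mhom_gid (Prop_irrelevance (o z oz') (o z oz)) phi_gid.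
  exact: id_arrow_eq.
move: (proj1 k) (proj2 k) => ox oy.
move: (ox) (oy) => /= [] ex [] ey; subst x y; try exact: Hid.
- have -> : k = line_edge n by apply: (@Prop_irrelevance (_ /\ _)).
  exact: e.
- have -> : k = ginv (line_edge n : hom line (LE n) _ _).
    exact: (@Prop_irrelevance (_ /\ _)).
  rewrite !mhom_ginv phi_ginv.
  exact: (congr1 (@inv_arrow _ _) (e _ _)).
Qed.

(** Moves that keep the length of a word.  In [WordComp] the composite is
    followed by an identity of the same local groupoid, so that no later arrow
    is shifted. *)
Inductive word_move : seq (local_arrow B) -> seq (local_arrow B) -> Prop :=
| WordStep s1 s2 g h of arrow_step g h :
    word_move (s1 ++ g :: s2) (s1 ++ h :: s2)
| WordComp s1 s2 a x y z (g : hom B a x y) (h : hom B a y z) :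
    word_move (s1 ++ [:: LocalArrow g, LocalArrow h & s2])
      (s1 ++ [:: LocalArrow (gcomp g h), LocalArrow (gid (gtgt h)) & s2]).

Lemma word_move_size w w' : word_move w w' -> size w = size w'.
Proof. by case=> *; rewrite !size_cat. Qed.

Lemma word_move_word w w' x y :
  word_move w w' -> is_word x w y <-> is_word x w' y.
Proof.
case=> [s1 s2 g h /arrow_step_ends[e1 e2]|s1 s2 a u v z g h].
  by split=> /is_word_cat[m p] /= q; apply/is_word_cat; exists m => //=;
    move: q; rewrite e1 e2.
by split=> /is_word_cat[m p] /= [e1 [e2 q]]; apply/is_word_cat; exists m.
Qed.

Section Rows.
Variables (x : X) (N : int).

Definition word_row w (m : int) : local_arrow B :=
  if (m < N)%R then initial_id x else nth (initial_id x) w `|(m - N)%R|%N.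

Lemma row_lt w m : (m < N)%R -> word_row w m = initial_id x.
Proof. by rewrite /word_row => ->. Qed.

Lemma row_ge w m : (N + (size w)%:Z <= m)%R -> word_row w m = initial_id x.
Proof.
move=> h; rewrite /word_row; case: ifP => // _; apply: nth_default; lia.
Qed.

Lemma row_nth w i : word_row w (N + i%:Z)%R = nth (initial_id x) w i.
Proof.
rewrite /word_row ifF; last by apply/negP; lia.
by congr nth; lia.
Qed.

Lemma int_ge (m : int) : (m < N)%R \/ exists i : nat, m = (N + i%:Z)%R.
Proof.
have [?|?] := boolP (m < N)%R; [by left | right; exists `|(m - N)%R|%N; lia].
Qed.

Lemma word_nth w y z i : is_word y w z ->
  la_tgt (nth (initial_id z) w i) = la_src (nth (initial_id z) w i.+1).
Proof.
elim: w y i => [|g w IH] y [|i] //= [_ p]; last exact: IH p.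
by case: w p {IH} => [-> //|h w [->]].
Qed.

Lemma word_src w y z : is_word y w z -> la_src (nth (initial_id z) w 0) = y.
Proof. by case: w => [-> //|g w []]. Qed.

Lemma row_tgt w m :
  is_word x w x -> la_tgt (word_row w m) = la_src (word_row w (m + 1)%R).
Proof.
move=> p; have [mN|[i ->]] := int_ge m; last first.
  have -> : (N + i%:Z + 1 = N + i.+1%:Z)%R by lia.
  by rewrite !row_nth; apply: word_nth p.
rewrite row_lt //; have [?|[i e]] := int_ge (m + 1)%R; first by rewrite row_lt.
have -> : (m + 1 = N + 0%:Z)%R by lia.
by rewrite row_nth (word_src p).
Qed.

(** One strip of a grid: vertical arrows [K] and squares of indices [D] between
    two consecutive rows.  The bound at [N] differs for [K] and [D] because the
    square at [m] has vertical sides at [m] and [m + 1]. *)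
Definition row_homotopy (k : nat) (G G' : int -> local_arrow B) : Prop :=
  exists (K : int -> local_arrow B) (D : int -> idx B),
  [/\ forall m, la_src (K m) = la_src (G m),
      forall m, la_tgt (K m) = la_src (G' m),
      forall m, square (D m) (G m) (K (m + 1)%R) (K m) (G' m),
      forall m, (m <= N)%R \/ (N + k%:Z <= m)%R -> K m = initial_id x
    & forall m, (m < N)%R \/ (N + k%:Z <= m)%R -> D m = alpha x].

Lemma arrow_step_initial_id a y (o : obj B a y) :
  arrow_step (initial_id y) (id_arrow o).
Proof. exact/arrow_step_gid/alpha_le. Qed.

Lemma square_arrow_step g h : arrow_step g h ->
  square (la_idx h) g (initial_id (la_tgt g)) (initial_id (la_src g)) h.
Proof.
case: h => a y z h st; have [e1 e2] := arrow_step_ends st; rewrite e1 e2 /=.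
apply: (@Square _ _ a y z y z h (gid (gtgt h)) (gid (gsrc h)) h) => //.
- by rewrite gcomp1l gcomp1r.
- by apply/arrow_step_gid/alpha_le/gtgt/h.
- by apply/arrow_step_gid/alpha_le/gsrc/h.
- exact: arrow_step_refl.
Qed.

Lemma square_sym d g k' k g' : square d g k' k g' ->
  square d g' (inv_arrow k') (inv_arrow k) g.
Proof.
case=> y z y' z' a c' c a' {}g {}k' {}k {}g' e sg sk' sk sg'.
apply: (@Square _ _ d y' z' y z a' (ginv c') (ginv c) a) => //.
- have ox := gsrc a; have oy' := gtgt c'.
  rewrite -(gcomp1l (gtgt c) a') -(gcompVl (gtgt c) c).
  rewrite -[gcomp (gcomp _ _) a']gcompA.
  by rewrite -e -!gcompA (gcompVr (gsrc c')) gcomp1r.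
- exact: arrow_step_inv sk'.
- exact: arrow_step_inv sk.
Qed.

Lemma row_homotopy_sym k G G' : row_homotopy k G G' -> row_homotopy k G' G.
Proof.
case=> K [D [Ks Kt sq Kc Dc]]; exists (fun m => inv_arrow (K m)), D; split=> //.
- by move=> m; apply: square_sym.
- by move=> m mN; rewrite Kc // /inv_arrow /= gidV.
Qed.

Lemma row_homotopy_arrow_step w w' : is_word x w x -> size w = size w' ->
  (forall m, arrow_step (word_row w m) (word_row w' m)) ->
  row_homotopy (size w) (word_row w) (word_row w').
Proof.
move=> p sw st; exists (fun m => initial_id (la_src (word_row w m))),
  (fun m => la_idx (word_row w' m)); split=> //.
- by move=> m; have [] := arrow_step_ends (st m).
- by move=> m; rewrite -row_tgt //; apply: square_arrow_step.
- move=> m [mN|mN]; last by rewrite row_ge.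
  have [?|?] := boolP (m < N)%R; first by rewrite row_lt.
  have -> : (m = N + 0%:Z)%R by lia.
  by rewrite row_nth (word_src p).
- by move=> m [mN|mN]; [rewrite row_lt | rewrite row_ge // -sw].
Qed.

Lemma row_cat1 s1 s2 g :
  word_row (s1 ++ g :: s2) (N + (size s1)%:Z)%R = g.
Proof. by rewrite row_nth nth_cat ltnn subnn. Qed.

Lemma row_cat_eq s1 s2 t t' m : size t = size t' ->
  (m < N + (size s1)%:Z)%R \/ (N + (size s1 + size t)%:Z <= m)%R ->
  word_row (s1 ++ t ++ s2) m = word_row (s1 ++ t' ++ s2) m.
Proof.
move=> e; have [?|[i ->]] := int_ge m; first by rewrite !row_lt.
rewrite !row_nth !nth_cat -e => h.
case: ifP => // h1; case: ifP => // h2; exfalso; lia.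
Qed.

(** For [WordComp] at position [i], the vertical arrow at [i + 1] is [h] and the
    others are identities: the square on its left has sides [g, h] and
    [id, gcomp g h], the one on its right [h, id] and [h, id]. *)
Lemma row_homotopy_word_move w w' : is_word x w x -> word_move w w' ->
  row_homotopy (size w) (word_row w) (word_row w').
Proof.
move=> p mv; have sw := word_move_size mv.
case: {w w'} mv p sw => [s1 s2 g h st p sw|s1 s2 a y1 y2 y3 g h p sw].
  apply: row_homotopy_arrow_step => // m.
  have [->|ne] := eqVneq m (N + (size s1)%:Z)%R; first by rewrite !row_cat1.
  rewrite (@row_cat_eq s1 s2 [:: g] [:: h]) //=; first exact: arrow_step_refl.
  lia.
set w := _ ++ _ in p sw *; set w' := s1 ++ _.
pose i := (N + (size s1)%:Z)%R.
have rg : word_row w i = LocalArrow g by apply: row_cat1.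
have rgh : word_row w' i = LocalArrow (gcomp g h) by apply: row_cat1.
have ei : (i + 1 = N + (size (rcons s1 (LocalArrow g)))%:Z)%R.
  by rewrite size_rcons /i; lia.
have ei' : (i + 1 = N + (size (rcons s1 (LocalArrow (gcomp g h))))%:Z)%R.
  by rewrite size_rcons /i; lia.
have rh : word_row w (i + 1)%R = LocalArrow h.
  by rewrite ei /w -cat_rcons row_cat1.
have rz : word_row w' (i + 1)%R = LocalArrow (gid (gtgt h)).
  by rewrite ei' /w' -cat_rcons row_cat1.
have req m : (m < i)%R \/ (i + 1 < m)%R -> word_row w m = word_row w' m.
  move=> h'; apply: (@row_cat_eq s1 s2 [:: _; _] [:: _; _]) => //=.
  by rewrite /i in h'; lia.
pose K m := if m == (i + 1)%R then LocalArrow h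
  else initial_id (la_src (word_row w m)).
have Kne m : m <> (i + 1)%R -> K m = initial_id (la_src (word_row w m)).
  by rewrite /K => /eqP/negPf ->.
have K1 : K (i + 1)%R = LocalArrow h by rewrite /K eqxx.
exists K, (fun m => la_idx (word_row w m)); split.
- move=> m; have [->|/eqP ne] := eqVneq m (i + 1)%R; first by rewrite K1 rh.
  by rewrite Kne.
- move=> m; have [->|/eqP ne] := eqVneq m (i + 1)%R; first by rewrite K1 rz.
  rewrite Kne //=; have [->|ne'] := eqVneq m i; first by rewrite rg rgh.
  by rewrite req //; lia.
- move=> m; have [->|/eqP ne] := eqVneq m (i + 1)%R.
    rewrite K1 (Kne (i + 1 + 1)%R) ?rh ?rz; last by lia.
    rewrite -row_tgt // rh /=.
    apply: (@Square _ _ a y2 y3 y3 y3 h (gid (gtgt h)) h (gid (gtgt h))) => //;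
      try exact: arrow_step_refl.
    by apply/arrow_step_gid/alpha_le/gtgt/h.
  have [->|ne'] := eqVneq m i.
    rewrite K1 (Kne i) ?rg ?rgh; last by lia.
    apply: (@Square _ _ a y1 y2 y1 y3 g h (gid (gsrc g)) (gcomp g h)) => //;
      try exact: arrow_step_refl.
    - by rewrite gcomp1l.
    - by apply/arrow_step_gid/alpha_le/gsrc/g.
  rewrite !Kne //; last by lia.
  rewrite -row_tgt // -req; last by lia.
  by apply/square_arrow_step/arrow_step_refl.
- move=> m mN; have szw : size w = (size s1 + (size s2).+2)%N.
    by rewrite size_cat.
  rewrite Kne; last by rewrite /i; lia.
  case: mN => mN; last by rewrite row_ge.
  have [?|?] := boolP (m < N)%R; first by rewrite row_lt.
  have -> : (m = N + 0%:Z)%R by lia.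
  by rewrite row_nth (word_src p).
- by move=> m [mN|mN]; [rewrite row_lt | rewrite row_ge].
Qed.

End Rows.

End RowHomotopies.

(** * From chains of moves to homotopies, and from edge loops to words *)

Lemma eqv_sequence (T : Type) (R : T -> T -> Prop) (t u : T) : eqv R t u ->
  exists (W : nat -> T) (L : nat), [/\ W 0 = t,
    forall i, (L <= i)%N -> W i = u
    & forall i, [\/ W i = W i.+1, R (W i) (W i.+1) | R (W i.+1) (W i)]].
Proof.
move=> tu; have {tu} := clos_rst_rst1n _ _ _ _ tu.
elim=> {t u} [t|t t' u tt' _ [W [L [W0 WL Ws]]]].
  by exists (fun=> t), 0; split=> // i; constructor 1.
exists (fun i => if i is j.+1 then W j else t), L.+1; split=> //.
- by case=> // i; apply: WL.
- case=> [|i]; last exact: Ws.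
  by rewrite W0; case: tt' => tt'; [constructor 2|constructor 3].
Qed.

Section Homotopies.
Variables (X : Type) (B : atlas X) (alpha : X -> idx B).
Hypothesis alphaP : forall x, initial x (alpha x).
Implicit Types (g h : local_arrow B) (s t w : seq (local_arrow B)).

Local Notation initial_id := (initial_id alphaP).
Local Notation word_move := (@word_move X B).

(** Row [n] of the grid is the [n]-th word of a chain from [w] to [w'], constant
    in [n] before and after the chain.  All the words have the same length, so
    one strip contains all that is not constant. *)
Lemma homotopy_of_word_moves x N w w' : is_word x w x -> eqv word_move w w' ->
  exists (H : mor (prod_atlas line line) B) (N0 N1 : int),
  [/\ forall m, arrow_at (mcomp (line_incl N0) H) m = word_row alphaP x N w m,
      forall m, arrow_at (mcomp (line_incl N1) H) m = word_row alphaP x N w' m,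
      forall n m, midx (mcomp (line_incl n) H) (LV m)
        = alpha (mfun (mcomp (line_incl n) H) m)
    & forall (s : idx (prod_atlas line line)) (u v : int * int)
             (f : hom (prod_atlas line line) s u v),
        ((u.1 < N)%R -> marrow H f = initial_id x) /\
        ((N + (size w)%:Z < v.1)%R -> marrow H f = initial_id x)].
Proof.
move=> p ww'; have [W [L [W0 WL Ws]]] := eqv_sequence ww'.
have Wp i : is_word x (W i) x /\ size (W i) = size w.
  elim: i => [|i [IH IHs]]; first by rewrite W0.
  case: (Ws i) => [<- //|mv|mv].
  - by rewrite -(word_move_size mv); split=> //; apply/(word_move_word _ _ mv).
  - by rewrite (word_move_size mv); split=> //; apply/(word_move_word _ _ mv).
pose nat_of (n : int) := if n is Posz i then i else 0.
pose G n := word_row alphaP x N (W (nat_of n)).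
have Gh n : row_homotopy alphaP x N (size w) (G n) (G (n + 1)%R).
  have self i : row_homotopy alphaP x N (size w) (word_row alphaP x N (W i))
      (word_row alphaP x N (W i)).
    have [ip <-] := Wp i; apply: row_homotopy_arrow_step => // m.
    exact: arrow_step_refl.
  have [[i ei]|e0] : (exists i, nat_of n = i /\ nat_of (n + 1)%R = i.+1) \/
      nat_of n = 0 /\ nat_of (n + 1)%R = 0.
  - case: n => i; first by left; exists i; split=> //; rewrite GRing.addrC.
    by right; split=> //; case: i.
  - rewrite /G; case: ei => -> ->; have [ip is_] := Wp i.
    have [jp js] := Wp i.+1; case: (Ws i) => [<- //|mv|mv].
    + by rewrite -is_; apply: row_homotopy_word_move.
    + by apply: row_homotopy_sym; rewrite -js; apply: row_homotopy_word_move.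
  - by rewrite /G; case: e0 => -> ->; apply: self.
have [K /choice[D KD]] := choice Gh.
have Gc n m : la_tgt (G n m) = la_src (G n (m + 1)%R).
  by apply: row_tgt; have [] := Wp (nat_of n).
have Ks n m : la_src (K n m) = la_src (G n m) by have [-> //] := KD n.
have Kt n m : la_tgt (K n m) = la_src (G (n + 1)%R m) by have [_ -> //] := KD n.
have sq n m : square (D n m) (G n m) (K n (m + 1)%R) (K n m) (G (n + 1)%R m).
  by have [_ _ sq _ _] := KD n.
pose H := grid_of_arrows alphaP Gc Ks Kt sq.
have Glt n m : (m < N)%R -> G n m = initial_id x by move=> ?; apply: row_lt.
have Gge n m : (N + (size w)%:Z <= m)%R -> G n m = initial_id x.
  by have [_ e] := Wp (nat_of n); rewrite -e; apply: row_ge.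
exists H, 0%R, (L%:Z)%R; split.
- by move=> m; rewrite grid_row /G /= W0.
- by move=> m; rewrite grid_row /G /= WL.
- by move=> n m.
case=> s t u v f.
have KDc n m : (m < N)%R \/ (N + (size w)%:Z <= m)%R ->
    [/\ G n m = initial_id x, K n m = initial_id x, K n (m + 1)%R = initial_id x
      & D n m = alpha x].
  have [_ _ _ Kc Dc] := KD n.
  move=> mN; split; [|by apply: Kc; lia|by apply: Kc; lia|exact: Dc].
  by case: mN => ?; [exact: Glt | exact: Gge].
split=> uv; apply: grid_const.
- case: s f => m [[/= k1 k1'] _].
    by move=> n; have [] := KDc n m; [left; rewrite -k1|].
  by move=> n; apply: KDc; left; case: k1 => /= e; lia.
- case: s f => m [[/= k1 k1'] _].
    by move=> n; have [] := KDc n m; [right; lia|].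
  by move=> n; apply: KDc; right; case: k1' => /= e; lia.
Qed.

Lemma eqv_cat s1 s2 t t' : eqv word_move t t' ->
  eqv word_move (s1 ++ t ++ s2) (s1 ++ t' ++ s2).
Proof.
apply: (eqv_map (f := fun t => s1 ++ t ++ s2)) => {t t'} _ _ [].
- move=> r1 r2 g h st; rewrite -!catA !(catA s1) /=.
  by apply/rst_step/WordStep.
- move=> r1 r2 a x y z g h; rewrite -!catA !(catA s1) /=.
  by apply/rst_step/WordComp.
Qed.

Lemma eqv_arrow_step_word g h :
  eqv (@arrow_step X B) g h -> eqv word_move [:: g] [:: h].
Proof.
apply: (eqv_map (f := fun g => [:: g])) => a b ab.
by apply/rst_step/(@WordStep _ _ [::] [::]).
Qed.

Lemma eqv_gid a y (o : obj B a y) :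
  eqv word_move [:: id_arrow o] [:: initial_id y].
Proof.
exact/eqv_arrow_step_word/rst_sym/rst_step/arrow_step_initial_id.
Qed.

(** An identity travels through a word to its end: written as an identity in the
    groupoid of the next arrow [g], it is absorbed by [g], which leaves an
    identity behind it. *)
Lemma eqv_shift y s z : is_word y s z ->
  eqv word_move (initial_id y :: s) (s ++ [:: initial_id z]).
Proof.
elim: s y => [|[a b c g] s IH] y /=; first by move=> ->; apply: rst_refl.
case=> e p; subst b.
apply: (@rst_trans _ _ _ [:: id_arrow (gsrc g), LocalArrow g & s]).
  by apply: (@eqv_cat [::] (_ :: _) [:: _] [:: _]); apply/rst_sym/eqv_gid.
apply: rst_trans.
  by apply: rst_step; apply: (@WordComp _ _ [::] s _ _ _ _ (gid (gsrc g)) g).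
rewrite gcomp1l /=.
have e := @eqv_cat [:: LocalArrow g] [::] _ _ (IH c p); rewrite !cats0 in e.
by apply: rst_trans e; apply: (@eqv_cat [:: _] s [:: _] [:: _]); apply: eqv_gid.
Qed.

Section Padded.
Variable x : X.

(** Padding on the right does not change the row of a word, which is already
    constant there; it makes room for moves that change the length. *)
Definition padded_eqv w w' : Prop :=
  exists j j', eqv word_move (w ++ nseq j (initial_id x))
    (w' ++ nseq j' (initial_id x)).

Lemma padded_eqv_of w w' : eqv word_move w w' -> padded_eqv w w'.
Proof. by move=> e; exists 0, 0; rewrite /= !cats0. Qed.

Lemma padded_sym w w' : padded_eqv w w' -> padded_eqv w' w.
Proof. by case=> j [j' e]; exists j', j; apply: rst_sym. Qed.

Lemma padded_trans w w' w'' :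
  padded_eqv w w' -> padded_eqv w' w'' -> padded_eqv w w''.
Proof.
case=> j [j' e] [k [k' e']]; exists (j + k), (k' + j').
have ee := @eqv_cat [::] (nseq k (initial_id x)) _ _ e.
have ee' := @eqv_cat [::] (nseq j' (initial_id x)) _ _ e'.
rewrite /= -!catA -!nseqD in ee ee'.
by apply: rst_trans ee _; rewrite addnC.
Qed.

Lemma padded_shift s y t : is_word y t x ->
  padded_eqv (s ++ initial_id y :: t) (s ++ t).
Proof.
move=> p; exists 0, 1; rewrite cats0 -catA.
by have := @eqv_cat s [::] _ _ (eqv_shift p); rewrite !cats0.
Qed.

Lemma padded_cancel s t a y z (g : hom B a y z) (h : hom B a z y) :
  gcomp g h = gid (gsrc g) -> is_word y t x ->
  padded_eqv (s ++ [:: LocalArrow g, LocalArrow h & t]) (s ++ t).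
Proof.
move=> gh p.
apply: padded_trans (padded_shift s p).
apply: padded_trans
  (padded_shift s (y := y) (t := initial_id y :: t) _); last by [].
apply: padded_eqv_of; apply: rst_trans.
  by apply: rst_step; apply: WordComp.
rewrite gh; apply: (@eqv_cat s t [:: _; _] [:: _; _]).
apply: (@rst_trans _ _ _ [:: id_arrow (gsrc g); initial_id y]).
  exact: (@eqv_cat [:: _] [::] [:: _] [:: _] (eqv_gid _)).
exact: (@eqv_cat [::] [:: _] [:: _] [:: _] (eqv_gid _)).
Qed.

End Padded.

Section Lifting.
Variables (K : sset) (vert : X -> simp K 0) (E : local_arrow B -> simp K 1).
Variables (M : nerve_model vert E) (x : X).
Local Notation v := (vert x).
Local Notation lift_path := (lift_path M).
Local Notation lift_edge := (lift_edge M).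

(** Each elementary move on edge loops becomes length-preserving moves followed
    by a shift of the superfluous identities to the end.  Representatives of
    edges are arbitrary, which costs only pushes along structural functors. *)
Lemma padded_emove (s1 s2 t1 t2 : seq (oedge K)) : emove t1 t2 ->
  is_epath v (s1 ++ t1 ++ s2) v ->
  padded_eqv x (lift_path (s1 ++ t1 ++ s2)) (lift_path (s1 ++ t2 ++ s2)).
Proof.
move=> mv /(lift_path_word M); rewrite /lift_path !map_cat.
move: (map _ s1) (map _ s2) => r1 r2.
case: mv => [u|a|t] /= /is_word_cat[y p /= ].
- have [z ez] := nm_vert_surj M u; subst u => -[_].
  have e : E (rep_arrow M (degen ord0 (vert z))) = degen ord0 (vert z).
    exact: rep_arrowK.
  have [_ ->] := degen_ends M e => q.
  apply: padded_trans (padded_shift r1 q).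
  apply: padded_eqv_of; apply: (@eqv_cat r1 r2 [:: _] [:: _]).
  apply: eqv_arrow_step_word; apply/(nm_eq M).
  by rewrite [LHS]e -(nm_gid M (proj1 (alphaP z))).
- case: a => e b [_]; rewrite /lift_edge /orev /=.
  case: b => /=; case: (rep_arrow M e) => a x1 x2 g /= [_ q].
    by apply: padded_cancel q; apply: gcompVr.
  by apply: padded_cancel q; apply: gcompVl.
- have [a [x1 [x2 [x3 [g [h [e2 e0 e1]]]]]]] := nm_tri M t.
  rewrite /lift_edge /= => -[_ [_]].
  have r2e : eqv (@arrow_step X B) (rep_arrow M (face ord_max t))
      (LocalArrow g).
    by apply/(nm_eq M); rewrite rep_arrowK.
  have r0e : eqv (@arrow_step X B) (rep_arrow M (face ord0 t)) (LocalArrow h).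
    by apply/(nm_eq M); rewrite rep_arrowK.
  have r1e : eqv (@arrow_step X B) (LocalArrow (gcomp g h))
      (rep_arrow M (face (lift ord0 ord0) t)).
    by apply/(nm_eq M); rewrite rep_arrowK.
  have [_ ->] := eqv_arrow_step_ends r0e => /= q.
  have := @padded_shift x (r1 ++ [:: rep_arrow M (face (lift ord0 ord0) t)])
    _ _ q.
  rewrite -!catA; apply: padded_trans.
  apply: padded_eqv_of; apply: (@eqv_cat r1 r2 [:: _; _] [:: _; _]).
  apply: rst_trans (@eqv_cat [::] [:: _] _ _ (eqv_arrow_step_word r2e)) _.
  apply: rst_trans (@eqv_cat [:: _] [::] _ _ (eqv_arrow_step_word r0e)) _.
  apply: rst_trans (rst_step _ _ _ _ (@WordComp _ _ [::] [::] _ _ _ _ g h)) _.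
  apply: rst_trans (@eqv_cat [::] [:: _] _ _ (eqv_arrow_step_word r1e)) _.
  exact: (@eqv_cat [:: _] [::] _ _ (eqv_gid _)).
Qed.

Lemma eqv_lift_nerve_path w : eqv word_move w (lift_path (nerve_path E w)).
Proof.
elim: w => [|g w IH]; first exact: rst_refl.
have e := @eqv_cat [:: g] [::] _ _ IH; rewrite !cats0 in e.
apply: rst_trans e _; apply: (@eqv_cat [::] _ [:: _] [:: _]).
by apply/eqv_arrow_step_word/(nm_eq M); rewrite /lift_edge /= rep_arrowK.
Qed.

(** Equality in the edge group is realized by moves on the words themselves. *)
Lemma padded_of_word_class w w' : is_word x w x -> is_word x w' x ->
  word_class vert E x w = word_class vert E x w' -> padded_eqv x w w'.
Proof.
move=> p p'; have q := nerve_path_epath M p; have q' := nerve_path_epath M p'.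
rewrite /word_class (edge_clsE q) (edge_clsE q') => ee; have e := cls_eqvP ee.
apply: padded_trans (padded_eqv_of x (eqv_lift_nerve_path w)) _.
apply: padded_trans (padded_sym (padded_eqv_of x (eqv_lift_nerve_path w'))).
suff H (r r' : eloop v) : eqv (@eloop_move K v) r r' ->
    padded_eqv x (lift_path (proj1_sig r)) (lift_path (proj1_sig r')).
  by apply: (H _ _ e).
elim=> {r r' ee e} [r r'|r|r r' _ IH|r r' r'' _ IH _ IH'].
- case=> s1 [s2] [t1] [t2] [mv er ->]; rewrite er.
  by apply: padded_emove => //; rewrite -er; apply: (proj2_sig r).
- by apply/padded_eqv_of/rst_refl.
- exact: padded_sym.
- exact: padded_trans IH IH'.
Qed.

End Lifting.

End Homotopies.

(** * The comparison isomorphism *)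

Section Iso.
Variables (X : Type) (B : atlas X) (alpha : X -> idx B).
Hypothesis alphaP : forall x, initial x (alpha x).
Variables (K : sset) (vert : X -> simp K 0) (E : local_arrow B -> simp K 1).
Variables (M : nerve_model vert E) (x : X).
Implicit Types (l : mor line B) (g h : local_arrow B).

Local Notation v := (vert x).
Local Notation word_class := (@word_class X B K vert E x).
Local Notation supported := (@supported X B K vert E x).
Local Notation initial_id := (initial_id alphaP).

Lemma word_class_eq s1 s2 g h : E g = E h ->
  word_class (s1 ++ g :: s2) = word_class (s1 ++ h :: s2).
Proof. by move=> e; rewrite /word_class /nerve_path !map_cat /= e. Qed.

(** Both sides are equal to the class with the diagonal of the square. *)
Lemma word_class_square s1 s2 d g k' k g' : square d g k' k g' ->
  is_word x (s1 ++ [:: g, k' & s2]) x ->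
  word_class (s1 ++ [:: g, k' & s2]) = word_class (s1 ++ [:: k, g' & s2]).
Proof.
case=> y z y' z' a c' c a' {}g {}k' {}k {}g' e sg sk' sk sg' p.
have [eg1 eg2] := arrow_step_ends sg; have [ek1 ek2] := arrow_step_ends sk'.
have Est g1 g2 : arrow_step g1 g2 -> E g1 = E g2.
  by move=> st; apply/(nm_eq M)/rst_step.
have q : is_word x (s1 ++ [:: LocalArrow a, LocalArrow c' & s2]) x.
  move: p => /is_word_cat[m p1 /=]; rewrite eg1 eg2 ek1 ek2 => p2.
  by apply/is_word_cat; exists m.
have q' : is_word x (s1 ++ [:: LocalArrow c, LocalArrow a' & s2]) x.
  by move: q => /is_word_cat[m p1 /= [e1 [_ p2]]]; apply/is_word_cat; exists m.
rewrite (word_class_eq _ _ (Est _ _ sg)) -cat_rcons.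
rewrite (word_class_eq _ _ (Est _ _ sk')) cat_rcons.
rewrite (word_class_gcomp M q) e -(word_class_gcomp M q').
rewrite [RHS](word_class_eq _ _ (Est _ _ sk)) -[in RHS]cat_rcons.
by rewrite [RHS](word_class_eq _ _ (Est _ _ sg')) cat_rcons.
Qed.

Lemma word_class_cat s t : is_word x s x -> is_word x t x ->
  word_class (s ++ t) = (word_class s * word_class t)%g.
Proof.
move=> /(nerve_path_epath M) p /(nerve_path_epath M) q.
by rewrite /word_class /nerve_path map_cat; apply: edge_cls_cat.
Qed.

Lemma word_class_window_eq l l' N k : mcls l = mcls l' ->
  word_class (window l N k) = word_class (window l' N k).
Proof.
move=> e; rewrite /word_class /nerve_path /window -!map_comp; congr edge_cls.
by apply: eq_map => i /=; rewrite (mcls_arrow_at M _ e).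
Qed.

(** The strict form of [supported], as given by stabilization; the grids built
    from words need it to start and end at the given path. *)
Definition id_outside l (N : int) (k : nat) : Prop :=
  forall n : int, (n < N)%R \/ (N + k%:Z <= n)%R ->
    exists a (o : obj B a x), arrow_at l n = id_arrow o.

Lemma id_outside_supported l N k : id_outside l N k -> supported l N k.
Proof. by move=> s n /s[a [o ->]]; apply: nm_gid M _ _ _. Qed.

Lemma stabilizes_id_outside l : stabilizes l x x ->
  exists N k, forall i j, id_outside l (N - i%:Z)%R (i + k + j).
Proof.
case=> [[N [a [o s]]] [N' [a' [o' s']]]].
exists N, `|(N' - N)%R|%N => i j n [nN|nN].
- by exists a, o; apply: s; lia.
- by exists a', o'; apply: s'; lia.
Qed.

Lemma path_supported (p : loop B x) :
  exists Nk : int * nat, supported (repr (path_class p)) Nk.1 Nk.2.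
Proof.
have [l e /stabilizes_id_outside[N [k s]]] := proj2_sig p.
exists ((N - 0)%R, (0 + k + 0)%N) => n nN.
have <- : E (arrow_at l n) = E (arrow_at (repr (path_class p)) n).
  by apply: (mcls_arrow_at M); rewrite /mcls reprK; apply: esym e.
by apply: id_outside_supported (s 0 0) _ nN.
Qed.

(** The edge class of a path, read on an arbitrary representative in an
    arbitrary window; [loop_clsE] shows that neither choice matters. *)
Definition loop_cls (p : loop B x) : edge_group v :=
  let Nk := projT1 (cid (path_supported p)) in
  word_class (window (repr (path_class p)) Nk.1 Nk.2).

Lemma loop_clsE p l N k : path_class p = mcls l -> supported l N k ->
  loop_cls p = word_class (window l N k).
Proof.
move=> e s; rewrite /loop_cls; case: cid => -[N' k'] /= s'.
have el : mcls (repr (path_class p)) = mcls l by rewrite /mcls reprK.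
rewrite -(word_class_window_eq _ _ el); apply: (word_class_window M s') => n nN.
by rewrite (mcls_arrow_at M _ el); apply: s.
Qed.

Section Homotopy.
Variable H : mor (prod_atlas line line) B.

Lemma line2_hom_irr (c : idx (prod_atlas line line)) p q
    (k k' : hom (prod_atlas line line) c p q) : k = k'.
Proof.
case: k k' => [k1 k2] [k1' k2'].
by congr pair; apply: (@Prop_irrelevance (_ /\ _)).
Qed.

Definition column_arrow (m n : int) : local_arrow B :=
  marrow H (((conj erefl erefl), line_edge n)
    : hom (prod_atlas line line) (LV m, LE n) (m, n) (m, (n + 1)%R)).

Lemma marrow_arrow_step a b (h : le a b) p q
    (bp : obj (prod_atlas line line) b p) (bq : obj (prod_atlas line line) b q)
    (k : hom (prod_atlas line line) a p q)
    (k' : hom (prod_atlas line line) b p q) :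
  arrow_step (marrow H k) (marrow H k').
Proof.
rewrite /marrow (line2_hom_irr k' (phi h bp bq k)) mhom_phi.
exact: ArrowStep.
Qed.

Lemma homotopy_square m n :
  square (midx H (LE m, LE n))
    (arrow_at (mcomp (line_incl n) H) m) (column_arrow (m + 1)%R n)
    (column_arrow m n) (arrow_at (mcomp (line_incl (n + 1)%R) H) m).
Proof.
have o0 i : line_set (LE i) i by left.
have o1 i : line_set (LE i) (i + 1)%R by right.
have sub0 i : le (LV i : idx line) (LE i) by move=> j ->.
have sub1 i : le (LV (i + 1)%R : idx line) (LE i) by move=> j ->.
have r i : le (LE i : idx line) (LE i) by apply: le_refl.
pose c : idx (prod_atlas line line) := (LE m, LE n).
pose arr (p q : int * int) (op : obj _ c p) (oq : obj _ c q)
    : hom (prod_atlas line line) c p q :=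
  (conj (proj1 op) (proj1 oq), conj (proj2 op) (proj2 oq)).
have o00 : obj (prod_atlas line line) c (m, n) by split; apply: o0.
have o10 : obj (prod_atlas line line) c ((m + 1)%R, n).
  by split; [apply: o1|apply: o0].
have o01 : obj (prod_atlas line line) c (m, (n + 1)%R).
  by split; [apply: o0|apply: o1].
have o11 : obj (prod_atlas line line) c ((m + 1)%R, (n + 1)%R).
  by split; apply: o1.
apply: (@Square _ _ _ _ _ _ _ (mhom H (arr _ _ o00 o10))
  (mhom H (arr _ _ o10 o11)) (mhom H (arr _ _ o00 o01))
  (mhom H (arr _ _ o01 o11))).
- by rewrite -!mhom_gcomp; congr mhom; apply: line2_hom_irr.
- exact: (@marrow_arrow_step (LE m, LV n) c (conj (r m) (sub0 n)) _ _ o00 o10).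
- exact: (@marrow_arrow_step (LV (m + 1)%R, LE n) c (conj (sub1 m) (r n))
    _ _ o10 o11).
- exact: (@marrow_arrow_step (LV m, LE n) c (conj (sub0 m) (r n)) _ _ o00 o01).
- exact: (@marrow_arrow_step (LE m, LV (n + 1)%R) c (conj (r m) (sub1 n))
    _ _ o01 o11).
Qed.

Variables (M0 M1 : int) (a0 a1 : idx B) (o0 : obj B a0 x) (o1 : obj B a1 x).
Hypothesis Hc : forall (s : idx (prod_atlas line line)) (u w : int * int)
    (f : hom (prod_atlas line line) s u w),
  ((u.1 < M0)%R -> marrow H f = id_arrow o0) /\
  ((M1 < w.1)%R -> marrow H f = id_arrow o1).

(* A window whose two boundary columns consist of identities: the source of a
   vertical arrow at [N] is to the left of [M0], its target at [N + k] to the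
   right of [M1]. *)
Let N := (M0 - 1)%R.
Let k := (`|(M1 - N)%R| + 1)%N.

Lemma homotopy_supported n : supported (mcomp (line_incl n) H) N k.
Proof.
apply: id_outside_supported => m [mN|mN].
- exists a0, o0; apply: (proj1 (Hc _)) => /=; rewrite /N in mN; lia.
- exists a1, o1; apply: (proj2 (Hc _)) => /=; rewrite /k in mN; lia.
Qed.

Lemma homotopy_word_class n :
  word_class (window (mcomp (line_incl n) H) N k)
    = word_class (window (mcomp (line_incl (n + 1)%R) H) N k).
Proof.
pose r := mcomp (line_incl n) H; pose r' := mcomp (line_incl (n + 1)%R) H.
have [rN rk] := supported_mfun M (homotopy_supported n).
have [rN' rk'] := supported_mfun M (homotopy_supported (n + 1)%R).
(* The loops [w i] follow row [n] up to [N + i], then the vertical arrow, then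
   row [n + 1]; two consecutive ones differ by a square, and the vertical arrows
   at both ends are identities. *)
pose w i := window r N i ++ column_arrow (N + i%:Z)%R n
  :: window r' (N + i%:Z)%R (k - i).
have ww i : (i <= k)%N -> is_word x (w i) x.
  move=> ik; apply/is_word_cat; exists (mfun r (N + i%:Z)%R).
    by have := window_word r N i; rewrite rN.
  split=> //=; have := window_word r' (N + i%:Z)%R (k - i).
  have -> : (N + i%:Z + (k - i)%:Z = N + k%:Z)%R by lia.
  by rewrite rk'; apply.
have step i : (i < k)%N -> word_class (w i.+1) = word_class (w i).
  move=> ik.
  have e1 : w i.+1 = window r N i ++ [:: arrow_at r (N + i%:Z)%R,
      column_arrow (N + i%:Z + 1)%R n & window r' (N + i%:Z + 1)%R (k - i.+1)].
    rewrite /w -addn1 window_cat -catA; congr cat.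
    rewrite {1}/window /=.
    by congr [:: arrow_at _ _, column_arrow _ _ & window _ _ _]; lia.
  have e2 : w i = window r N i ++ [:: column_arrow (N + i%:Z)%R n,
      arrow_at r' (N + i%:Z)%R & window r' (N + i%:Z + 1)%R (k - i.+1)].
    rewrite /w; congr (_ ++ _ :: _).
    have -> : (k - i = 1 + (k - i.+1))%N by lia.
    rewrite window_cat {1}/window /=.
    by congr [:: arrow_at _ _ & window _ _ _]; lia.
  rewrite e1 e2; apply: (word_class_square (homotopy_square _ _)).
  by have := ww i.+1 ik; rewrite e1; apply.
have all i : (i <= k)%N -> word_class (w i) = word_class (w 0).
  elim: i => // i IH ik; rewrite step // IH //; exact: ltnW.
have c0 : E (column_arrow (N + 0%:Z)%R n) = degen ord0 (vert x).
  rewrite /column_arrow (proj1 (Hc _)) /=; last by rewrite /N; lia.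
  exact: nm_gid M _ _ _.
have ck : E (column_arrow (N + k%:Z)%R n) = degen ord0 (vert x).
  rewrite /column_arrow (proj2 (Hc _)) /=; last by rewrite /k; lia.
  exact: nm_gid M _ _ _.
have e0 : word_class (w 0) = word_class (window r' N k).
  have := @word_class_degen _ _ _ _ _ M x [::] _ _ _ c0 (ww 0 (leq0n _)).
  move=> e; rewrite [LHS]e /= subn0; congr (word_class (window _ _ _)); lia.
have ek : word_class (w k) = word_class (window r N k).
  have e := @word_class_degen _ _ _ _ _ M x _ _ _ _ ck (ww k (leqnn k)).
  by rewrite [LHS]e subnn cats0.
by rewrite -[LHS]ek -[RHS]e0 all.
Qed.

Lemma homotopy_word_class_all n n' :
  word_class (window (mcomp (line_incl n) H) N k)
    = word_class (window (mcomp (line_incl n') H) N k).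
Proof.
pose F m := word_class (window (mcomp (line_incl m) H) N k).
suff up m i : F m = F (m + i%:Z)%R.
  have [nn|nn] : (n <= n')%R \/ (n' <= n)%R by lia.
    have -> : n' = (n + `|(n' - n)%R|%N%:Z)%R by lia.
    exact: up.
  have -> : n = (n' + `|(n - n')%R|%N%:Z)%R by lia.
  exact/esym/up.
elim: i => [|i IH]; first by rewrite GRing.addr0.
have -> : (m + i.+1%:Z = m + i%:Z + 1)%R by lia.
by rewrite IH; apply: homotopy_word_class.
Qed.

End Homotopy.

Lemma homotopic_loop_cls (p q : loop B x) :
  homotopic p q -> loop_cls p = loop_cls q.
Proof.
case=> H [N0 [N1 [M0 [M1 [a0 [a1 [o0 [o1 [ep eq Hc]]]]]]]]].
rewrite (loop_clsE (esym ep) (homotopy_supported Hc N0)).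
rewrite (loop_clsE (esym eq) (homotopy_supported Hc N1)).
exact: (homotopy_word_class_all Hc N0 N1).
Qed.

(** The row of a padded window of [l] is below [l]: the two agree inside the
    window, and outside it an identity of the initial groupoid is compared with
    an identity of [l]. *)
Lemma row_window_arrow_step l N k j m : id_outside l N k ->
  arrow_step (word_row alphaP x N (window l N k ++ nseq j (initial_id x)) m)
    (arrow_at l m).
Proof.
move=> s; have [mN|[i ->]] := int_ge N m.
  rewrite row_lt //; have [|a [o ->]] := s m; first by left.
  exact: arrow_step_initial_id.
rewrite row_nth nth_cat size_map size_iota; case: ltnP => ik.
  rewrite (nth_map 0) ?size_iota // nth_iota // add0n.
  exact: arrow_step_refl.
rewrite nth_nseq if_same; have [|a [o ->]] := s (N + i%:Z)%R.
  by right; lia.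
exact: arrow_step_initial_id.
Qed.

(** Both loops are read in a common window, so that the two rows are placed at
    the same integers and no translation of the line is needed. *)
Lemma loop_cls_homotopic (p q : loop B x) :
  loop_cls p = loop_cls q -> homotopic p q.
Proof.
have [l ep sl] := proj2_sig p; have [l' eq sl'] := proj2_sig q.
have [N1 [k1 s1]] := stabilizes_id_outside sl.
have [N2 [k2 s2]] := stabilizes_id_outside sl'.
have [N [k [s s']]] : exists N k, id_outside l N k /\ id_outside l' N k.
  pose d := `|(N1 - N2)%R|%N.
  exists (N1 - d%:Z)%R, (d + k1 + (d + k2))%N; split; first exact: s1.
  have := s2 `|(N2 - N1 + d%:Z)%R|%N (`|(N1 - N2 + d%:Z)%R|%N + k1)%N.
  by congr id_outside; rewrite /d; lia.
have t := id_outside_supported s; have t' := id_outside_supported s'.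
rewrite (loop_clsE ep t) (loop_clsE eq t') => e.
have w := supported_word M t; have w' := supported_word M t'.
have [j [j' mv]] := padded_of_word_class alphaP M w w' e.
have wj : is_word x (window l N k ++ nseq j (initial_id x)) x.
  apply/is_word_cat; exists x => //.
  by elim: (j) => //= j0 IH; split.
have [H [N0 [N0' [Hl Hl' Hv Hc]]]] := homotopy_of_word_moves alphaP N wj mv.
exists H, N0, N0', N, (N + (size (window l N k ++ nseq j (initial_id x)))%:Z)%R.
exists (alpha x), (alpha x), (proj1 (alphaP x)), (proj1 (alphaP x)); split=> //.
- rewrite /path_class ep; apply/cls_eqv/rst_step/(tri_of_arrows alphaP) => // m.
  by rewrite Hl; apply: row_window_arrow_step.
- rewrite /path_class eq; apply/cls_eqv/rst_step/(tri_of_arrows alphaP) => // m.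
  by rewrite Hl'; apply: row_window_arrow_step.
Qed.

Lemma loop_cls_surj (u : edge_group v) : exists p, loop_cls p = u.
Proof.
elim/eg_ind: u => r.
pose w := lift_path M (proj1_sig r).
have p : is_word x w x by apply/lift_path_word/(proj2_sig r).
have [m|l le_] := line_exists alphaP (G := word_row alphaP x 0%R w).
  exact: row_tgt.
have s : stabilizes l x x.
  split; [exists 0%R|exists (size w)%:Z%R];
    exists (alpha x), (proj1 (alphaP x)) => n nw; rewrite le_.
    exact: row_lt.
  by apply: row_ge; lia.
pose q : loop B x := exist _ (mcls l) (ex_intro2 _ _ l erefl s); exists q.
have t : id_outside l 0%R (size w).
  move=> n nw; exists (alpha x), (proj1 (alphaP x)); rewrite le_.
  by case: nw => nw; [exact: row_lt|exact: row_ge].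
rewrite (loop_clsE (erefl : path_class q = mcls l) (id_outside_supported t)).
have -> : window l 0%R (size w) = w.
  rewrite -[RHS](mkseq_nth (initial_id x)); apply: eq_map => i.
  by rewrite le_ row_nth.
by rewrite (word_class_lift_path M) ?edge_cls_proj //; apply: (proj2_sig r).
Qed.

Lemma loop_cls_concat (p q r : loop B x) : path_concat p q r ->
  loop_cls r = (loop_cls p * loop_cls q)%g.
Proof.
case=> l [m [c [ep eq er [sl sm sc [N [k [lN mN cl cm]]]]]]].
have [[N1 l1] _] := sl; have [_ [N2 m2]] := sm.
pose i := `|(N - N1)%R|%N; pose j := `|(N2 - (N + k))%R|%N.
have ol : id_outside l (N - i%:Z)%R i.
  move=> n [nN|nN].
    by case: l1 => a [o l1]; exists a, o; apply: l1; rewrite /i in nN; lia.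
  by case: lN => a [o lN]; exists a, o; apply: lN; lia.
have om : id_outside m (N + k)%R j.
  move=> n [nN|nN]; first by case: mN => a [o mN]; exists a, o; apply: mN.
  by case: m2 => a [o m2]; exists a, o; apply: m2; rewrite /j in nN; lia.
have oc : id_outside c (N - i%:Z)%R (i + j).
  move=> n [nN|nN]; first by rewrite cl; [apply: ol; left|lia].
  by rewrite cm; [apply: om; right; lia|lia].
have tl := id_outside_supported ol; have tm := id_outside_supported om.
rewrite (loop_clsE ep tl) (loop_clsE eq tm).
rewrite (loop_clsE er (id_outside_supported oc)) window_cat.
rewrite -(word_class_cat (supported_word M tl) (supported_word M tm)).
congr (word_class (_ ++ _)); apply/eq_in_map => n; rewrite mem_iota => ni.
  by apply: cl; lia.
by rewrite cm; [congr arrow_at; lia|lia].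
Qed.

(** The translation by [k] brings the left end of the support of the second loop
    to the right end of that of the first. *)
Lemma concat_exists (p q : loop B x) : exists r : loop B x, path_concat p q r.
Proof.
have [l ep sl] := proj2_sig p; have [m eq sm] := proj2_sig q.
have [[N1 l1] [N lN]] := sl; have [[N' mN'] [N2 m2]] := sm.
pose k := (N' - N)%R.
pose G n := if (n < N)%R then arrow_at l n else arrow_at m (n + k)%R.
have Glt n : (n < N)%R -> G n = arrow_at l n by rewrite /G => ->.
have Gge n : (N <= n)%R -> G n = arrow_at m (n + k)%R.
  by move=> h; rewrite /G ifF //; apply/negP; lia.
have mx : mfun m N' = x.
  case: mN' => a [o e]; have en : (N' - 1 < N')%R by lia.
  by have /= <- := congr1 (@la_tgt _ _) (e _ en); congr mfun; lia.
have lx : mfun l N = x.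
  case: lN => a [o e].
  exact: (congr1 (@la_src _ _) (e N (Order.POrderTheory.lexx N))).
have [n|c ce] := line_exists alphaP (G := G).
  have [h|h] : (n + 1 < N)%R \/ n = (N - 1)%R \/ (N <= n)%R by lia.
    by rewrite !Glt //; lia.
  case: h => [->|h]; last first.
    by rewrite !Gge /=; [congr mfun; lia|lia|lia].
  rewrite Glt ?Gge /=; [|lia|lia].
  transitivity x; first by rewrite -lx; congr mfun; lia.
  by rewrite -mx; congr mfun; rewrite /k; lia.
have sc : stabilizes c x x.
  split.
  - case: l1 => a [o l1]; exists (if (N1 < N)%R then N1 else N), a, o => n nN.
    by rewrite ce Glt; [apply: l1|]; move: nN; case: ifP; lia.
  - case: m2 => a [o m2]; exists (N + `|(N2 - k - N)%R|%N%:Z)%R, a, o => n nN.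
    by rewrite ce Gge; [apply: m2|]; lia.
exists (exist _ (mcls c) (ex_intro2 _ _ c erefl sc)), l, m, c; split=> //.
split=> //; exists N, k; split=> //.
- by have -> : (N + k = N')%R by rewrite /k; lia.
- by move=> i iN; rewrite ce Glt.
- by move=> i iN; rewrite ce Gge.
Qed.

Theorem loop_classes_iso : exists h : loop_classes B x -> edge_group v,
  bijective h /\
  forall u w z : loop_classes B x,
    loop_classes_mul u w z <-> h z = (h u * h w)%g.
Proof.
pose cl (p : loop B x) : loop_classes B x := cls _ p.
have clP p q : cl p = cl q <-> loop_cls p = loop_cls q.
  split=> [e|e].
    apply: homotopic_loop_cls; have /(congr1 (@proj1_sig _ _)) /= -> := e.
    exact: loop_cls_homotopic.
  apply: eq_exist; apply/funext => r; apply/propext; split=> h;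
    apply: loop_cls_homotopic; first by rewrite -e; apply: homotopic_loop_cls.
  by rewrite e; apply: homotopic_loop_cls.
pose h (u : loop_classes B x) := loop_cls (repr u).
have hE p : h (cl p) = loop_cls p by apply/clP; rewrite /cl reprK.
exists h; split.
  pose g (a : edge_group v) := cl (projT1 (cid (loop_cls_surj a))).
  exists g => [u|a]; last by rewrite hE; case: cid.
  by transitivity (cl (repr u)); [apply/clP; case: cid | exact: reprK].
move=> u w z; split.
  case=> p [q [r [-> -> -> c]]]; rewrite !hE; exact: loop_cls_concat.
move=> e; have [r c] := concat_exists (repr u) (repr w).
exists (repr u), (repr w), r; rewrite !reprK; split=> //.
transitivity (cl (repr z)); first exact/esym/reprK.
by apply/clP; rewrite (loop_cls_concat c); apply: e.
Qed.

End Iso.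

(** * The nerve is a model *)

Section RegularNerve.
Variables (X : Type) (C : atlas X) (vert : X -> simp (regular_nerve C) 0).
Hypothesis vert_bij : bijective vert.
Hypothesis vertE : forall a x (o : obj C a x),
  vert x = simplex_cls
    (existT _ a (existT (chain (loc a) 0) x o) : pre_simplex C 0).

Definition pre_edge (g : local_arrow C) : pre_simplex C 1 :=
  existT _ (la_idx g) (existT (chain _ 1) (la_src g)
    (@cons_chain _ _ 0 _ _ (la_arr g) (gtgt (la_arr g)))).

Definition edge_arrow (s : pre_simplex C 1) : local_arrow C :=
  LocalArrow (projT2 (projT2 (projT2 s))).1.

Definition nerve_edge (g : local_arrow C) : simp (regular_nerve C) 1 :=
  simplex_cls (pre_edge g).

Lemma pre_edgeK s : pre_edge (edge_arrow s) = s.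
Proof.
case: s => a [x c]; have [y [g [o ->]]] := chainP c.
by rewrite /pre_edge /= (Prop_irrelevance (gtgt g) o).
Qed.

Lemma edge_arrow_step s t : simplex_step s t ->
  arrow_step (edge_arrow s) (edge_arrow t).
Proof.
case=> a b h x bx c; have [y [g [o ->]]] := chainP c.
exact: ArrowStep.
Qed.

Lemma pre_edge_step g h :
  arrow_step g h -> simplex_step (pre_edge g) (pre_edge h).
Proof.
case=> a b ab x y bx by_ k.
have := SimplexStep ab bx (@cons_chain _ _ 0 _ _ k (gtgt k)).
rewrite /pre_edge /= (Prop_irrelevance (inter_components ab k bx) by_).
by rewrite (Prop_irrelevance (gtgt (phi ab bx by_ k)) by_).
Qed.

Lemma nerve_edge_eq g h :
  nerve_edge g = nerve_edge h <-> eqv (@arrow_step X C) g h.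
Proof.
split=> [e|]; last first.
  move=> e; apply: cls_eqv; apply: eqv_map e => a b ab.
  exact/rst_step/pre_edge_step.
have := cls_eqvP e => /(eqv_map (f := edge_arrow)) {}e.
have := e (@arrow_step X C); case: g h {e} => [a x y g] [b x' y' h]; apply.
by move=> s t st; apply/rst_step/edge_arrow_step.
Qed.

Definition pre_triangle a x y z (g : hom C a x y) (h : hom C a y z) :
    pre_simplex C 2 :=
  existT _ a (existT (chain _ 2) x
    (@cons_chain _ _ 1 _ _ g (@cons_chain _ _ 0 _ _ h (gtgt h)))).

Lemma triangle_faces a x y z (g : hom C a x y) (h : hom C a y z)
    (t := simplex_cls (pre_triangle g h) : simp (regular_nerve C) 2) :
  [/\ face ord_max t = nerve_edge (LocalArrow g),
      face ord0 t = nerve_edge (LocalArrow h)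
    & face (lift ord0 ord0) t = nerve_edge (LocalArrow (gcomp g h))].
Proof.
rewrite /t /= !simplex_faceE; split; congr simplex_cls => //.
- by rewrite /pre_face /pre_edge /= (Prop_irrelevance (gsrc h) (gtgt g)).
- rewrite /pre_face /pre_edge /=.
  by rewrite (Prop_irrelevance (gtgt (gcomp g h)) (gtgt h)).
Qed.

(** The hypothesis [vertE] holds over a good atlas, where all identities at a
    point are identified through the initial index. *)
Lemma regular_nerve_model : nerve_model vert nerve_edge.
Proof.
split.
- exact: bij_inj vert_bij.
- by case: vert_bij => f _ fK u; exists (f u).
- case=> a x y g; rewrite /d1 [LHS]simplex_faceE /=.
  by rewrite (vertE (gsrc g)).
- case=> a x y g; rewrite /d0 [LHS]simplex_faceE /=.
  by rewrite (vertE (gtgt g)).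
- move=> a x o; rewrite (vertE o) [RHS]simplex_degenE.
  congr simplex_cls.
  by rewrite /pre_edge /= (Prop_irrelevance (gtgt (gid o)) o).
- exact: nerve_edge_eq.
- elim/simplex_ind => s; exists (edge_arrow s).
  by rewrite /nerve_edge pre_edgeK.
- by move=> a x y z g h; eexists; apply: triangle_faces.
- elim/simplex_ind => -[a [x c]].
  have [y [g [c1 ->]]] := chainP c; have [z [h [o ->]]] := chainP c1.
  exists a, x, y, z, g, h.
  rewrite (Prop_irrelevance (o : gobj (loc a) z) (gtgt h)).
  exact: triangle_faces.
Qed.

End RegularNerve.

Section ModelOfRegularization.
Variables (X : Type) (A : atlas X) (alpha : X -> idx A).
Hypothesis alphaP : forall x, initial x (alpha x).
Variables (K : sset) (vert : X -> simp K 0).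
Variable E : local_arrow (reg A) -> simp K 1.
Hypothesis M : nerve_model vert E.

Definition incl_arrow (g : local_arrow A) : local_arrow (reg A) :=
  @LocalArrow X (reg A) (inl (la_idx g)) (la_src g) (la_tgt g) (la_arr g).

(** The regularization adds one trivial groupoid per point, whose arrow is
    already represented by the identity of the initial groupoid of [A]: sending
    it there is compatible with the structural functors. *)
Definition retract_arrow (g : local_arrow (reg A)) : local_arrow A :=
  match g with
  | @LocalArrow _ _ (inl a) x y k => @LocalArrow X A a x y k
  | @LocalArrow _ _ (inr _) x _ _ => initial_id alphaP x
  end.

Lemma incl_arrow_step g h :
  arrow_step g h -> arrow_step (incl_arrow g) (incl_arrow h).
Proof.
case=> a b ab x y bx by_ k.
exact: (@ArrowStep _ (reg A) (inl a) (inl b) ab x y bx by_ k).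
Qed.

Lemma retract_arrow_step g h : arrow_step g h ->
  eqv (@arrow_step X A) (retract_arrow g) (retract_arrow h).
Proof.
case=> -[a|z] [b|w] //= ab x y bx by_ k.
- exact/rst_step/ArrowStep.
- case: k => e1 e2; move: (e1) (e2) => /= ? ?; subst x y.
  rewrite (Prop_irrelevance (etrans _ _) erefl) /=.
  by apply/rst_step/arrow_step_gid/alpha_le.
- exact: rst_refl.
Qed.

Lemma incl_trivial a x (o : obj A a x) (z := inr x : idx (reg A))
    (k : hom (reg A) z x x) :
  E (LocalArrow k) = E (incl_arrow (id_arrow o)).
Proof.
apply/(nm_eq M)/rst_step.
have := @arrow_step_gid X (reg A) z (inl a) o x (erefl x) o.
rewrite /id_arrow; congr (arrow_step (LocalArrow _) _).
exact: (@Prop_irrelevance (_ /\ _)).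
Qed.

(** For a good atlas [A], regularizing changes neither the edges nor the
    triangles up to structural functors, so a model over [reg A] restricts to
    one over [A]. *)
Lemma reg_nerve_model : nerve_model vert (E \o incl_arrow).
Proof.
split.
- exact: nm_vert_inj M.
- exact: nm_vert_surj M.
- by move=> g; apply: nm_src M (incl_arrow g).
- by move=> g; apply: nm_tgt M (incl_arrow g).
- by move=> a x o; apply: (@nm_gid _ _ _ _ _ M (inl a) x o).
- move=> g h; split=> [e|e].
    have {}e := proj1 (nm_eq M _ _) e.
    have := eqv_map (f := retract_arrow) retract_arrow_step e.
    by case: g h {e} => [? ? ? ?] [].
  apply/(nm_eq M); apply: eqv_map e => a b ab.
  exact/rst_step/incl_arrow_step.
- move=> e; have [[[a|z] x y g] <-] := nm_surj M e.
    by exists (@LocalArrow X A a x y g).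
  exists (initial_id alphaP z); case: (g) => e1 e2.
  move: (e1) (e2) => /= ? ?; subst x y.
  exact/esym/incl_trivial.
- by move=> a x y z g h; apply: (@nm_gcomp _ _ _ _ _ M (inl a) x y z g h).
- move=> t; have [[a|z] [x [x' [x'' [g [h [e2 e0 e1]]]]]]] := nm_tri M t.
    by exists a, x, x', x'', g, h.
  have o := proj1 (alphaP z).
  exists (alpha z), z, z, z, (gid o), (gid o).
  case: (g) (h) => f1 f2 [f3 f4].
  move: (f1) (f2) (f4) => /= ? ? ?; subst x x' x''.
  by rewrite gcomp1l e2 e0 e1; split; apply: incl_trivial.
Qed.

End ModelOfRegularization.

Lemma nerve_vertexE (X : Type) (A : atlas X) (a : idx (reg A)) (x : X)
    (o : obj (reg A) a x) :
  nerve_vertex A x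
    = simplex_cls (existT _ a (existT (chain (loc a) 0) x o)
                     : pre_simplex (reg A) 0).
Proof.
apply/cls_eqv/rst_step.
have h : le (inr x : idx (reg A)) a by move: (o); case: (a) => //= y ->.
exact: (@SimplexStep _ (reg A) 0 _ _ h x o (erefl x)).
Qed.

Theorem proposition5p2p7 (X : Type) (A : atlas X) (x : X) :
  exists h : pi1 A x -> edge_group (nerve_vertex A x),
    bijective h /\
    forall u v w : pi1 A x, pi1_mul u v w <-> h w = (h u * h v)%g.
Proof.
have M := regular_nerve_model (nerve_vertex_bij A) (@nerve_vertexE X A).
pose iso (B : atlas X) :=
  exists h : loop_classes B x -> edge_group (nerve_vertex A x), bijective h /\
    forall u v w : loop_classes B x,
      loop_classes_mul u v w <-> h w = (h u * h v)%g.
rewrite -[exists h, _]/(iso (good_model A)) /good_model.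
case: pselect => [gA|ngA].
  have [alpha alphaP] := choice gA.
  exact: (loop_classes_iso alphaP (reg_nerve_model alphaP M) x).
have regA : good (reg A) by move=> y; case: (reg_regular A y) => a; exists a.
have [alpha alphaP] := choice regA.
exact: (loop_classes_iso alphaP M x).
Qed.
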